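(* Let $x>0$ with $E_{Q^e}[W]>x$. Suppose that the set $\mathcal{Q}$ satisfies conditions (i)–(iv) of the context and that the following hold. (Finiteness of the value function of $U$) For every $y>0$ there exists $Q_0\in\mathcal{Q}_e$ such that $\sup_{X\in\mathcal{X}(y)}E_{Q_0}[U(X)]<\infty$. (Finiteness of the value function of $U_c$) There is $Q_0\in\mathcal{Q}_e$ such that $\sup_{X\in\mathcal{X}(y)}E_{Q_0}[U_c(X)]<\infty$ for some, and hence for all, $y>0$. (Atomless conditional distribution) $(\Omega,\mathcal{F})$ is a standard Borel space, and there is a function $P:\mathcal{F}\times(0,\infty)\to[0,\infty)$ such that for all $v>0$, $P(\cdot,v)$ is an atomless probability measure, and for all $A\in\mathcal{F}$, $P(A,\cdot)$ is measurable and $P(A,W)=\mathbb{P}(A\mid W)$ almost surely. Then $$\sup_{X\in\mathcal{X}^W_x}\inf_{Q\in\mathcal{Q}_e}E_Q[U_c^{W}(X)]=\sup_{X\in\mathcal{X}^W_x}\inf_{Q\in\mathcal{Q}}E_Q[U_c^{W}(X)]=\inf_{Q\in\mathcal{Q}}\sup_{X\in\mathcal{X}^W_x}E_Q[U_c^{W}(X)]=\inf_{Q\in\mathcal{Q}_e}\sup_{X\in\mathcal{X}^W_x}E_Q[U_c^{W}(X)]=\inf_{Q\in\mathcal{Q}_e}\sup_{X\in\mathcal{X}^W_x}E_Q[U^{W}(X)],$$ $$\sup_{X\in\mathcal{X}^W_x}\inf_{Q\in\mathcal{Q}_e}E_Q[U^{W}(X)]\le \sup_{X\in\mathcal{X}^W_x}\inf_{Q\in\mathcal{Q}_e}E_Q[U_c^{W}(X)],$$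 and $$\sup_{X\in\mathcal{X}^W_x}\inf_{Q\in\mathcal{Q}_e}E_Q[U^{W}(X)]=\sup_{X\in\mathcal{X}^W_x}\inf_{Q\in\mathcal{Q}}E_Q[U^{W}(X)]\le\inf_{Q\in\mathcal{Q}}\sup_{X\in\mathcal{X}^W_x}E_Q[U^{W}(X)]\le\inf_{Q\in\mathcal{Q}_e}\sup_{X\in\mathcal{X}^W_x}E_Q[U^{W}(X)].$$
   Context: $(\Omega,\mathcal{F},\mathbb{P})$ is a probability space. $Q^e$ is the unique equivalent local martingale measure of a complete market model; for the statement it is just a fixed probability measure on $(\Omega,\mathcal{F})$ equivalent to $\mathbb{P}$. $\mathcal{Q}$ is a set of probability measures on $(\Omega,\mathcal{F})$, and $\mathcal{Q}_e$ is the set of those $Q\in\mathcal{Q}$ equivalent to $\mathbb{P}$. Conditions on $\mathcal{Q}$: (i) $\mathcal{Q}$ is convex; (ii) $\mathbb{P}[A]=0$ if and only if $Q[A]=0$ for all $Q\in\mathcal{Q}$; (iii) $\mathcal{Z}:=\{dQ/d\mathbb{P}: Q\in\mathcal{Q}\}$ is closed in $L^0(\mathbb{P})$; (iv) $\mathcal{Z}_e:=\{dQ/d\mathbb{P}: Q\in\mathcal{Q}_e\}$ is closed in $L^0(\mathbb{P})$. ($L^0(\mathbb P)$ carries convergence in probability.) $U:[0,\infty)\to\mathbb{R}$ is non-decreasing, upper-semicontinuous, and $\lim_{y\to\infty}U(y)/y=0$; it is not assumed concave. The concavification $f_c$ of a function $f$ on $[0,\infty)$ is the smallest concave function on $[0,\infty)$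 with $f_c\ge f$. For $k>0$, $U^k(y):=U(y\wedge k)$, $y\ge0$, and $U^k_c$ is the concavification of $U^k$. $W:\Omega\to(0,\infty)$ is a random variable. For a random variable $X\ge0$, $U^W(X)$ and $U_c^W(X)$ denote the random variables $\omega\mapsto U^{W(\omega)}(X(\omega))$ and $\omega\mapsto U_c^{W(\omega)}(X(\omega))$. For $y>0$, $\mathcal{X}(y):=\{X\in L^1(Q^e): X\ge0,\ E_{Q^e}[X]\le y\}$ and $\mathcal{X}^W_y:=\{X\in L^1(Q^e): 0\le X\le W,\ E_{Q^e}[X]\le y\}$. $E_Q$ is expectation under $Q$. *)

(* Defs.v *)
From HB Require Import structures.
From mathcomp Require Import all_boot all_order all_algebra.
From mathcomp Require Import ring.
From mathcomp Require Import all_classical all_reals all_analysis.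
From mathcomp Require Import measurable_realfun.

Set Implicit Arguments.
Unset Strict Implicit.
Unset Printing Implicit Defensive.

Import Order.TTheory GRing.Theory Num.Theory.
Import numFieldNormedType.Exports.

Local Open Scope classical_set_scope.
Local Open Scope ring_scope.

(* A function on [0, +oo[ is represented by a total function R -> R; only its  *)
(* values on [0, +oo[ are ever constrained or used.                            *)

Section UtilityFunctions.
Context {R : realType}.
Implicit Types f g U : R -> R.

Definition concave_on_nneg f :=
  convex_function (`[0, +oo[%classic : set (convex_lmodType R^o))
    (fun y => - f y).

Definition concave_majorant f g :=
  concave_on_nneg g /\ (forall y, 0 <= y -> f y <= g y).

(* The smallest concave majorant, as a pointwise infimum. It is meaningful as  *)
(* soon as a concave majorant exists (concavificationP); this is the case for  *)
(* sublinear and for eventually constant non-decreasing functions              *)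
(* (sublinear_concave_majorant, truncation_concave_majorant).                  *)
Definition concavification f (y : R) : R :=
  inf [set g y | g in concave_majorant f].

Definition truncation U (k y : R) : R := U (Num.min y k).

Definition nondecreasing_on_nneg U :=
  forall y z, 0 <= y -> y <= z -> U y <= U z.

Definition usc_on_nneg U :=
  forall y a, 0 <= y -> U y < a ->
    \forall z \near within `[0, +oo[%classic (nbhs y), U z < a.

Definition sublinear U := (fun y => U y / y) @ +oo%R --> (0 : R).

Lemma concave_on_nnegP f : concave_on_nneg f <->
  (forall t y z, 0 <= t <= 1 -> 0 <= y -> 0 <= z ->
     t * f y + (1 - t) * f z <= f (t * y + (1 - t) * z)).
Proof.
have nnegE (y : R) : (y \in (`[0, +oo[%classic : set R)) = (0 <= y).
  by apply/idP/idP; rewrite inE /= in_itv /= andbT.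
have negE (t a b c : R) :
    (- c <= t * - a + (1 - t) * - b) = (t * a + (1 - t) * b <= c).
  by rewrite !mulrN -opprD lerN2.
split=> [cf t y z t01 y0 z0 | cf t y z].
  have := cf (Itv01 (andP t01).1 (andP t01).2) y z.
  by rewrite !nnegE => /(_ y0 z0) cfyz; rewrite -negE.
rewrite !nnegE => y0 z0.
have := cf t%:num y z _ y0 z0; rewrite -negE; apply.
by apply/andP; split.
Qed.

Lemma concavificationP f : concave_majorant f !=set0 ->
  concave_majorant f (concavification f) /\
  (forall g, concave_majorant f g ->
     forall y, 0 <= y -> concavification f y <= g y).
Proof.
move=> [g0 Hg0].
have ne y : [set g y | g in concave_majorant f] !=set0 by exists (g0 y), g0.
have lb y : 0 <= y -> lbound [set g y | g in concave_majorant f] (f y).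
  by move=> y0 _ [g [_ fg] <-]; exact: fg.
have le_inf g y : concave_majorant f g -> 0 <= y -> concavification f y <= g y.
  by move=> fg y0; apply: ge_inf; [exists (f y); exact: lb | exists g].
split; last by move=> g fg y; exact: le_inf.
split; last by move=> y y0; apply: lb_le_inf => //; exact: lb.
apply/concave_on_nnegP => t y z /[dup] t01 /andP[t0 t1] y0 z0.
apply: lb_le_inf => // _ [g fg <-].
apply: le_trans ((concave_on_nnegP g).1 fg.1 t y z t01 y0 z0).
by rewrite lerD // ler_wpM2l ?subr_ge0 // le_inf.
Qed.

Lemma affine_concave_majorant f a b :
  (forall y, 0 <= y -> f y <= a + b * y) ->
  concave_majorant f (fun y => a + b * y).
Proof.
move=> fab; split=> //; apply/concave_on_nnegP => t y z _ _ _.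
by rewrite le_eqVlt; apply/orP; left; apply/eqP; ring.
Qed.

Lemma truncation_concave_majorant U k : nondecreasing_on_nneg U -> 0 < k ->
  concave_majorant (truncation U k) !=set0.
Proof.
move=> ndU k0; exists (fun y => U k + 0 * y); apply: affine_concave_majorant.
move=> y y0; rewrite mul0r addr0; apply: ndU; last by rewrite ge_min lexx orbT.
by rewrite le_min y0 ltW.
Qed.

Lemma sublinear_concave_majorant U : nondecreasing_on_nneg U -> sublinear U ->
  concave_majorant U !=set0.
Proof.
move=> ndU /cvgrPdist_lt /(_ 1 ltr01) [M [_ UM]].
pose m := Num.max M 0 + 1.
have mM : M < m by rewrite ltr_pwDr // le_max lexx.
have m0 : 0 < m by rewrite ltr_pwDr // le_max lexx orbT.
exists (fun y => `|U m| + 1 * y); apply: affine_concave_majorant => y y0.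
rewrite mul1r; have [ym|my] := leP y m.
  by rewrite (le_trans (ndU _ _ y0 ym)) // (le_trans (ler_norm _)) // lerDl.
have /UM : M < y by exact: lt_trans mM my.
rewrite /= sub0r normrN => /(le_lt_trans (ler_norm _)).
rewrite ltr_pdivrMr ?mul1r ?(lt_trans m0) // => /ltW /le_trans; apply.
by rewrite lerDr.
Qed.

End UtilityFunctions.

Section RandomVariables.
Local Open Scope charge_scope.
Local Open Scope ereal_scope.
Context {R : realType} {d : measure_display} {Omega : measurableType d}.
Implicit Types (P Q : probability Omega R) (QQ : set (probability Omega R)).

Definition equivalent_probability P Q := Q `<< P /\ P `<< Q.

Definition equivalent_part P QQ := QQ `&` equivalent_probability P.

(* A measure of the library assigns a value to every subset, so a mixture is   *)
(* only compared with a member of QQ on the measurable sets.                   *)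
Definition convex_probabilities QQ :=
  forall Q1 Q2 (t : R), QQ Q1 -> QQ Q2 -> (0 <= t <= 1)%R ->
  exists2 Q, QQ Q & forall A, measurable A ->
    Q A = t%:E * Q1 A + (1 - t)%:E * Q2 A.

Definition same_null_sets P QQ :=
  forall A, measurable A -> P A = 0 <-> (forall Q, QQ Q -> Q A = 0).

(* The library derivative is the constant -oo when Q is not dominated by P;    *)
(* under same_null_sets P QQ every Q in QQ is dominated by P.                  *)
Definition densities P QQ : set {mfun Omega >-> R} :=
  [set Z : {mfun Omega >-> R} | exists2 Q, QQ Q &
     EFin \o Z = 'd (charge_of_finite_measure Q) '/d P %[ae P]].

Definition cvg_in_probability P (Z_ : {mfun Omega >-> R}^nat)
    (Z : {mfun Omega >-> R}) :=
  forall e : R, (0 < e)%R ->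
    P [set w | (e <= `|Z_ n w - Z w|)%R] @[n --> \oo] --> 0.

(* Convergence in probability is metrizable, so closedness in L^0(P) is        *)
(* sequential closedness.                                                      *)
Definition closed_in_L0 P (S : set {mfun Omega >-> R}) :=
  forall (Z_ : {mfun Omega >-> R}^nat) (Z : {mfun Omega >-> R}),
    (forall n, S (Z_ n)) -> cvg_in_probability P Z_ Z -> S Z.

(* X(y) and X^W_y; elements of L^1(Qe) that are (almost surely) nonnegative,   *)
(* resp. between 0 and W, are represented by versions satisfying the bounds    *)
(* everywhere.                                                                 *)
Definition claims (Qe : probability Omega R) (y : R) : set (Omega -> R) :=
  [set X : Omega -> R | [/\ X \in Lfun Qe 1, forall w, (0 <= X w)%R
                        & 'E_Qe[X] <= y%:E]].

Definition claims_below (Qe : probability Omega R) (W : Omega -> R) (y : R)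
    : set (Omega -> R) :=
  [set X : Omega -> R | [/\ X \in Lfun Qe 1, forall w, (0 <= X w <= W w)%R
                        & 'E_Qe[X] <= y%:E]].

Definition utilW (U : R -> R) (W X : Omega -> R) : Omega -> R :=
  fun w => truncation U (W w) (X w).

Definition utilWc (U : R -> R) (W X : Omega -> R) : Omega -> R :=
  fun w => concavification (truncation U (W w)) (X w).

Definition sup_inf (XX : set (Omega -> R)) QQ
    (u : (Omega -> R) -> (Omega -> R)) : \bar R :=
  ereal_sup [set ereal_inf [set 'E_Q[u X] | Q in QQ] | X in XX].

Definition inf_sup (XX : set (Omega -> R)) QQ
    (u : (Omega -> R) -> (Omega -> R)) : \bar R :=
  ereal_inf [set ereal_sup [set 'E_Q[u X] | X in XX] | Q in QQ].

Definition atomless P :=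
  forall A, measurable A -> 0 < P A ->
  exists B, [/\ measurable B, B `<=` A, 0 < P B & P B < P A].

(* g is a version of P[A | W] *)
Definition is_cond_probability P (W : {mfun Omega >-> R}) (A : set Omega)
    (g : Omega -> R) :=
  [/\ measurable_fun [set: g_sigma_algebra_preimageType W] g,
      P.-integrable setT (EFin \o g)
    & forall B, g_sigma_algebra_preimage W B ->
        \int[P]_(w in B) (g w)%:E = P (A `&` B)].

(* The kernel is total in v; its values at v <= 0 are irrelevant.              *)
Definition atomless_cond_distribution P (W : {mfun Omega >-> R}) :=
  exists K : R -> probability Omega R,
    (forall v, (0 < v)%R -> atomless (K v)) /\
    (forall A, measurable A ->
       measurable_fun (`]0%R, +oo[%classic : set R) (fun v => K v A) /\
       exists2 g, is_cond_probability P W A g &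
         \forall w \ae P, K (W w) A = (g w)%:E).

End RandomVariables.

(* Omega is Borel isomorphic to a Polish space T; a pseudometric is a metric   *)
(* exactly when its topology is Hausdorff.                                     *)
Definition standard_borel (R : realType) (d : measure_display)
    (Omega : measurableType d) :=
  exists (T : completePseudoMetricType R) (f : Omega -> T),
    [/\ hausdorff_space T,
        exists2 D : set T, countable D & dense D,
        bijective f
      & @measurable d Omega =
          preimage_set_system setT f <<s [set V : set T | open V] >>].

(* Main.v *)
Require Import Defs.
From HB Require Import structures.
From mathcomp Require Import all_boot all_order all_algebra.
From mathcomp Require Import ring lra.
From mathcomp Require Import all_classical all_reals all_analysis.
From mathcomp Require Import measurable_realfun.

(* The minimax equality needs no weak compactness.  If no density Z in the     *)
(* convex, L^0-closed set of densities satisfied all constraints               *)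
(* E_P[u(X) Z] <= b, then finitely many X would already be contradictory:      *)
(* near minimizers of the strictly convex functional Z |-> E_P[1/(1+Z)] under  *)
(* finitely many constraints converge almost surely, and the constraints pass  *)
(* to the limit by Fatou.  For finitely many X, separation in the plane and    *)
(* induction give a single convex combination beating b for every Q.           *)
(*                                                                             *)
(* For a fixed Q equivalent to P, the concavified and the original value       *)
(* coincide.  The conditional laws given W being atomless, P charges no point, *)
(* so an approximate Lyapunov theorem makes the set of attainable pairs        *)
(* (E_Qe[X], E_Q[U^W(X)]) approximately convex.  This yields a multiplier mu   *)
(* for the budget constraint, and the pointwise supremum over y of             *)
(* U^W(y) - mu (dQe/dQ) y, reached by a measurable selection among countably   *)
(* many levels y, is the intercept of an affine majorant of U^W; hence the     *)
(* Lagrange bound holds for U_c^W as well.                                     *)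

(** The chain of values combines three facts.

    Restricting [QQ] to its members equivalent to [P] changes no infimum in the equalities. Mix a
    little of the measure [Q0] from the finiteness assumption into an arbitrary [Q]: by convexity
    the mixture stays in [QQ], it is equivalent to [P], and its value exceeds that of [Q] by as
    little as desired ([inf_sup_equivalent_part]). Applied to a single payoff this gives the sup-inf
    equalities, applied to the whole family of concavified payoffs the inf-sup one.

    For the concavified utility the payoff is concave in [X] and affine in [Q], so sup and inf over
    all of [QQ] commute ([robust_minimax]). Given [b] below the inf-sup value, every [Q] is beaten
    at level [b] by some bounded claim. [convex_constraints_compact] reduces these claims to
    finitely many, and [finite_minimax] merges those into one claim that is good against every [Q]
    at once, at any level [a < b].

    For a fixed [Q] equivalent to [P], concavifying does not raise the supremum over claims
    ([concavified_value_le]). Pasting two claims along a suitable event nearly realises any mixture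
    of their costs and utilities, so the budget constraint has a multiplier although [U] is not
    concave; the Lagrange bound is affine in the level of the claim, hence it passes to the smallest
    concave majorant.

    The inequalities are [U^W <= U_c^W], weak duality, and the inclusion of the equivalent measures
    in [QQ]. *)

Set Implicit Arguments.
Unset Strict Implicit.
Unset Printing Implicit Defensive.

Import Order.TTheory GRing.Theory Num.Theory.
Import numFieldNormedType.Exports.

Local Open Scope classical_set_scope.
Local Open Scope ring_scope.

(** * Finite minimax *)

Section Minimax.
Context {R : realType}.

(* Approximate convexity up to domination suffices: a segment between points   *)
(* whose slopes are incompatible enters the open negative quadrant.            *)
Lemma separate_quadrant (A : set (R * R)) :
  (forall p q t e, A p -> A q -> 0 <= t <= 1 -> 0 < e ->
     exists r, [/\ A r, r.1 <= t * p.1 + (1 - t) * q.1 + e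
                 & r.2 <= t * p.2 + (1 - t) * q.2 + e]) ->
  (forall p, A p -> 0 < p.1 \/ 0 < p.2) ->
  exists2 l, 0 <= l <= 1 & forall p, A p -> 0 <= l * p.1 + (1 - l) * p.2.
Proof.
move=> cA A_pos.
(* A point with [p.1 <= 0] forces [l <= p.2 / (p.2 - p.1)], one with [q.2 <= 0] forces
   [l >= - q.2 / (q.1 - q.2)]; cleared of denominators, this says that the two bounds are
   compatible. *)
have cross (p q : R * R) : A p -> A q -> p.1 <= 0 -> q.2 <= 0 ->
    q.2 * p.1 <= q.1 * p.2.
  move=> Ap Aq p1 q2.
  have p2 : 0 < p.2 by case: (A_pos _ Ap) => // /(le_lt_trans p1); rewrite ltxx.
  have q1 : 0 < q.1 by case: (A_pos _ Aq) => // /(le_lt_trans q2); rewrite ltxx.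
  rewrite leNgt; apply/negP => qp.
  have p1' : p.1 < 0.
    rewrite lt_neqAle p1 andbT; apply: contraTneq qp => ->.
    by rewrite mulr0 -leNgt mulr_ge0 // ltW.
  have q2' : q.2 < 0.
    rewrite lt_neqAle q2 andbT; apply: contraTneq qp => ->.
    by rewrite mul0r -leNgt mulr_ge0 // ltW.
  pose d := (q.1 - p.1) + (p.2 - q.2).
  have d0 : 0 < d by rewrite /d; lra.
  (* the point of the segment on which both coordinates agree *)
  pose t := (q.1 - q.2) / d.
  have t01 : 0 <= t <= 1.
    apply/andP; split; first by apply: divr_ge0; lra.
    by rewrite /t ler_pdivrMr // mul1r /d; lra.
  have tE : t * d = q.1 - q.2 by rewrite /t divfK // gt_eqF.
  have e1 : t * p.1 + (1 - t) * q.1 = t * p.2 + (1 - t) * q.2.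
    by move: tE; rewrite /d => h; nra.
  have neg : t * p.1 + (1 - t) * q.1 < 0.
    have : (t * p.1 + (1 - t) * q.1) * d = q.1 * p.2 - q.2 * p.1.
      transitivity (t * d * p.1 + (d - t * d) * q.1); first by ring.
      by rewrite tE /d; ring.
    by move=> h; rewrite -(pmulr_llt0 _ d0) h; nra.
  have [|r [Ar r1 r2]] := cA p q t (- (t * p.1 + (1 - t) * q.1)) Ap Aq t01.
    by rewrite oppr_gt0.
  by rewrite addrN in r1; rewrite -e1 addrN in r2; have := A_pos _ Ar; lra.
(* All lower bounds on the weight; their supremum is the weight sought. *)
pose B := [set l : R | l = 0 \/ exists2 q, A q & q.2 <= 0 /\ l = - q.2 / (q.1 - q.2)].
have B0 : B 0 by left.
have B1 : ubound B 1.
  move=> _ [->//|[q Aq [q2 ->]]].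
  have q1 : 0 < q.1 by case: (A_pos _ Aq) => //; lra.
  by rewrite ler_pdivrMr; lra.
have hB : has_sup B by split; [exists 0 | exists 1].
exists (sup B).
  by apply/andP; split; [exact: (ub_le_sup hB.2 B0) | apply: ge_sup; [exists 0|]].
move=> p Ap.
have [p1|p1] := leP p.1 0; last have [p2|p2] := leP p.2 0; last first.
- have s0 : 0 <= sup B by exact: (ub_le_sup hB.2 B0).
  have s1 : sup B <= 1 by apply: ge_sup; [exists 0|].
  by nra.
- have : - p.2 / (p.1 - p.2) <= sup B.
    by apply: (ub_le_sup hB.2); right; exists p.
  rewrite ler_pdivrMr; last by lra.
  by move=> h; nra.
have p2 : 0 < p.2 by case: (A_pos _ Ap) => //; lra.
have : sup B <= p.2 / (p.2 - p.1).
  apply: ge_sup; first by exists 0.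
  move=> _ [->|[q Aq [q2 ->]]]; first by apply: divr_ge0; lra.
  have q1 : 0 < q.1 by case: (A_pos _ Aq) => //; lra.
  rewrite ler_pdivrMr; last by lra.
  rewrite mulrAC ler_pdivlMr; last by lra.
  by have := cross _ _ Ap Aq p1 q2; nra.
rewrite ler_pdivlMr; last by lra.
by move=> h; nra.
Qed.

(** Induction on [F], with [D] free to shrink. On the part of [D] where the head [i] does not exceed
    [b], the tail does, so induction gives one [j] above the midpoint [c] there. Everywhere on [D]
    one of [f i - a], [f j - a] is then positive, and separation in the plane provides the weight
    with which to mix [i] and [j]. The gap [a < b] pays for the strictness lost at each step. *)
Lemma finite_minimax (T I : Type) (S : set I) (f : I -> T -> R) (F : seq I) :
  (forall i j t, S i -> S j -> 0 <= t <= 1 -> exists2 k, S k &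
     forall p, t * f i p + (1 - t) * f j p <= f k p) ->
  S !=set0 -> (forall i, List.In i F -> S i) ->
  forall (D : set T) (a b : R), a < b ->
  (forall p q t, D p -> D q -> 0 <= t <= 1 -> exists2 r, D r &
     forall i, S i -> f i r = t * f i p + (1 - t) * f i q) ->
  (forall p, D p -> exists2 i, List.In i F & b < f i p) ->
  exists2 k, S k & forall p, D p -> a <= f k p.
Proof.
move=> concS [i0 Si0]; elim: F => [|i F IH] SF D a b ab convD Db.
  by exists i0 => // p /Db[].
have Si : S i by apply: SF; left.
pose c := (a + b) / 2.
have ac : a < c by rewrite /c; lra.
have cb : c < b by rewrite /c; lra.
have [|||j Sj jc] := IH _ [set p | D p /\ f i p <= b] _ _ cb.
- by move=> j Fj; apply: SF; right.
- move=> p q t [Dp pb] [Dq qb] t01; have [r Dr rE] := convD _ _ _ Dp Dq t01.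
  by exists r => //; split => //; rewrite rE //; nra.
- by move=> p [Dp pb]; have [j [<-|Fj] jb] := Db _ Dp; [lra|exists j].
have [||l l01 hl] := @separate_quadrant [set (f i p - a, f j p - a) | p in D].
- move=> _ _ t e [p Dp <-] [q Dq <-] t01 e0; have [r Dr rE] := convD _ _ _ Dp Dq t01.
  exists (f i r - a, f j r - a); rewrite !rE //=; split; [by exists r; rewrite ?rE|lra|lra].
- move=> _ [p Dp <-] /=; have [pb|pb] := leP (f i p) b; last by left; lra.
  by right; have := jc p (conj Dp pb); lra.
have [k Sk kl] := concS i j l Si Sj l01; exists k => // p Dp.
apply: le_trans (kl p).
by have := hl _ (ex_intro2 _ _ p Dp erefl); rewrite /=; lra.
Qed.

End Minimax.

(** * Approximate Lyapunov theorem *)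

Section ApproximateLyapunov.
Context {R : realType} {d : measure_display} {T : measurableType d}.

(** Replaces a sequence of refining partitions: cutting successively by the [C n] leaves at most one
    point in the limit. *)
Definition separating (C : nat -> set T) :=
  forall x y, (forall n, C n x <-> C n y) -> x = y.

(** Bisection: if the whole space were bad, one half of each cut by [C n] would stay bad, hence of
    mass above [e]. The intersection of these halves has at most one point, so it is null, against
    continuity from above. *)
Lemma separating_not_atom (C : nat -> set T) (M : {finite_measure set T -> \bar R})
    (good : set T -> Prop) (e : R) :
  (forall n, measurable (C n)) -> separating C ->
  (forall x, M [set x] = 0%E) -> 0 < e ->
  (forall S, measurable S -> (M S <= e%:E)%E -> good S) ->
  (forall S B, measurable S -> measurable B ->
     good (S `&` B) -> good (S `\` B) -> good S) ->
  good setT.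
Proof.
move=> mC sepC M0 e0 good_small good_split; apply: contrapT => bad.
pose next n (S : set T) := if `[< good (S `&` C n) >] then S `\` C n else S `&` C n.
pose S := fix S n := if n is n'.+1 then next n' (S n') else setT.
have SS n : S n.+1 = next n (S n) by [].
have mS n : measurable (S n).
  elim: n => [|n IH]; first exact: measurableT.
  rewrite SS /next; case: ifP => _.
    by apply: measurableD => //; exact: mC.
  by apply: measurableI => //; exact: mC.
have badS n : ~ good (S n).
  elim: n => [//|n IH]; rewrite SS /next; case: ifPn => [/asboolP g1 g2|/asboolP//].
  by apply: IH; apply: (good_split _ (C n)).
have S_gt n : (e%:E <= M (S n))%E.
  rewrite leNgt; apply/negP => /ltW Sn; apply: (badS n).
  exact: good_small.
have Sdec n : S n.+1 `<=` S n.
  by rewrite SS /next; case: ifP => _ x [].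
have Snd : nonincreasing_seq S.
  by apply/nonincreasing_seqP => n; apply/subsetPset; exact: Sdec.
have Me : (e%:E <= M (\bigcap_n S n))%E.
  have cvgS : M \o S @ \oo --> M (\bigcap_n S n).
    apply: nonincreasing_cvg_mu => //; last exact: bigcap_measurable.
    by rewrite (le_lt_trans (le_measure _ _ _ (@subsetT _ _))) ?inE// fin_num_fun_lty.
  rewrite -(cvg_lim _ cvgS)//; apply: lime_ge; first by apply/cvg_ex; eexists; exact: cvgS.
  by apply: nearW => n; exact: S_gt.
have agree x y n : (\bigcap_n S n) x -> (\bigcap_n S n) y -> C n x -> C n y.
  move=> /(_ n.+1 I) + /(_ n.+1 I); rewrite SS /next.
  by case: ifP => _ [_ ?] [_ ?].
have [[x Sx]|S0] := pselect (exists x, (\bigcap_n S n) x).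
  move: Me; suff -> : \bigcap_n S n = [set x] by rewrite M0 lee_fin leNgt e0.
  apply/seteqP; split=> [y Sy /=|_ ->//].
  by apply: sepC => n; split; exact: agree.
move: Me; suff -> : \bigcap_n S n = set0 by rewrite measure0 lee_fin leNgt e0.
by apply/seteqP; split=> // x Sx; case: S0; exists x.
Qed.

Definition additive_on_measurable (v : set T -> R) :=
  forall A B, measurable A -> measurable B -> A `&` B = set0 ->
  v (A `|` B) = v A + v B.

(* A random subset keeping each piece of a fine partition with probability t   *)
(* has variance at most the mesh; choosing piece by piece derandomizes this.   *)
Lemma approximate_lyapunov (C : nat -> set T) (M : {finite_measure set T -> \bar R})
    (v1 v2 : set T -> R) (t e : R) :
  (forall n, measurable (C n)) -> separating C ->
  (forall x, M [set x] = 0%E) ->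
  additive_on_measurable v1 -> additive_on_measurable v2 ->
  (forall A, measurable A -> `|v1 A| + `|v2 A| <= fine (M A)) ->
  0 <= t <= 1 -> 0 < e ->
  exists A, [/\ measurable A, `|v1 A - t * v1 setT| <= e
              & `|v2 A - t * v2 setT| <= e].
Proof.
move=> mC sepC M0 add1 add2 vM /andP[t0 t1] e0.
have Mfin A : measurable A -> M A \is a fin_num by exact: fin_num_measure.
have v0 v : additive_on_measurable v -> v set0 = 0.
  move=> addv; have := addv set0 set0 measurable0 measurable0.
  rewrite setU0 set0I => /(_ erefl); lra.
have MU A B : measurable A -> measurable B -> A `&` B = set0 ->
    fine (M (A `|` B)) = fine (M A) + fine (M B).
  by move=> mA mB AB; rewrite measureU // fineD // Mfin.
pose k := fine (M setT) + 1.
have k0 : 0 < k by rewrite ltr_wpDl // fine_ge0.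
(* The squared error allowed per unit of mass; the [+ 1] in [k] keeps the quotient defined when [M]
   vanishes. *)
pose dl := e ^+ 2 / k.
have dl0 : 0 < dl by rewrite divr_gt0 // exprn_gt0.
(* Quantifying over the errors [s1], [s2] accumulated so far is what lets two disjoint pieces be
   treated one after the other. *)
pose good S := forall s1 s2, exists2 A, measurable A /\ A `<=` S &
  (s1 + v1 A - t * v1 S) ^+ 2 + (s2 + v2 A - t * v2 S) ^+ 2
    <= s1 ^+ 2 + s2 ^+ 2 + dl * fine (M S).
have : good setT.
  apply: (@separating_not_atom C M good dl) => //.
    move=> S mS MS s1 s2.
    have mm : `|v1 S| ^+ 2 + `|v2 S| ^+ 2 <= dl * fine (M S).
      have MSe : fine (M S) <= dl by rewrite -lee_fin fineK ?Mfin.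
      have abc := vM _ mS.
      apply: (@le_trans _ _ (fine (M S) * fine (M S))); last first.
        by rewrite ler_wpM2r // fine_ge0.
      apply: le_trans (ler_pM _ _ abc abc); rewrite ?addr_ge0 //.
      have := mulr_ge0 (normr_ge0 (v1 S)) (normr_ge0 (v2 S)); lra.
    rewrite !real_normK ?num_real // in mm.
    have [h|h] := leP ((s1 + v1 S - t * v1 S) ^+ 2 + (s2 + v2 S - t * v2 S) ^+ 2)
      (s1 ^+ 2 + s2 ^+ 2 + dl * fine (M S)); first by exists S => //; split.
    exists set0; first by split => //; exact: measurable0.
    rewrite !v0 // !addr0; move: h mm.
    move: (v1 S) (v2 S) (dl * fine (M S)) => a b c h mm.
    rewrite leNgt; apply/negP => h'.
    (* [X1] and [X0] are the squared errors after keeping and after discarding [S]. Their mean with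
       weights [t] and [1 - t] is within the allowance, so they cannot both exceed it. *)
    set X0 := (X in _ < X) in h'; set X1 := (X in _ < X) in h.
    have XE : t * X1 + (1 - t) * X0
        = s1 ^+ 2 + s2 ^+ 2 + t * (1 - t) * (a ^+ 2 + b ^+ 2) by rewrite /X0 /X1; ring.
    have ab0 : 0 <= a ^+ 2 + b ^+ 2 by rewrite addr_ge0 // sqr_ge0.
    have tt : t * (1 - t) * (a ^+ 2 + b ^+ 2) <= a ^+ 2 + b ^+ 2.
      by rewrite ler_piMl //; nra.
    have t1' : 0 <= 1 - t by lra.
    by have [X01|X10] := leP X0 X1; [have := mulr_ge0 t0 (eqbRL (subr_ge0 _ _) X01)
      | have := mulr_ge0 t1' (eqbRL (subr_ge0 _ _) (ltW X10))]; lra.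
  move=> S B mS mB g1 g2 s1 s2.
  have [A1 [mA1 A1S] h1] := g1 s1 s2.
  have [A2 [mA2 A2S] h2] := g2 (s1 + v1 A1 - t * v1 (S `&` B)) (s2 + v2 A1 - t * v2 (S `&` B)).
  have mSB : measurable (S `&` B) by exact: measurableI.
  have mSD : measurable (S `\` B) by exact: measurableD.
  have dSB : (S `&` B) `&` (S `\` B) = set0.
    by apply/seteqP; split=> // x [[_ Bx] [_ /(_ Bx)]].
  have dA : A1 `&` A2 = set0.
    apply/seteqP; split=> // x [/A1S xB /A2S xD].
    by rewrite -[X in X x]dSB.
  have SE : S = (S `&` B) `|` (S `\` B) by rewrite setUIDK.
  exists (A1 `|` A2).
    split; first exact: measurableU.
    by move=> x [/A1S[]|/A2S[]].
  have vS v : additive_on_measurable v -> v S = v (S `&` B) + v (S `\` B).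
    by move=> addv; rewrite [in LHS]SE addv.
  have mE : fine (M S) = fine (M (S `&` B)) + fine (M (S `\` B)).
    by rewrite [in LHS]SE MU.
  rewrite mE (vS _ add1) (vS _ add2) add1 // add2 //.
  have -> (s x y z w : R) : s + (x + y) - t * (z + w) = s + x - t * z + y - t * w.
    by ring.
  have -> (s x y z w : R) : s + (x + y) - t * (z + w) = s + x - t * z + y - t * w.
    by ring.
  by lra.
move=> /(_ 0 0)[A [mA _]].
rewrite !add0r expr0n /= addr0 add0r => h.
have dlM : dl * fine (M setT) <= e ^+ 2.
  rewrite /dl mulrAC ler_pdivrMr // ler_pM2l ?exprn_gt0 // /k; lra.
have sq (x y : R) : x ^+ 2 + y ^+ 2 <= e ^+ 2 -> `|x| <= e.
  move=> xy; have y2 := sqr_ge0 y; have x2 : `|x| ^+ 2 = x ^+ 2 by rewrite real_normK ?num_real.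
  by rewrite leNgt; apply/negP => ex; nra.
by exists A; split => //; [|rewrite addrC in h]; exact: sq (le_trans h dlM).
Qed.

End ApproximateLyapunov.

(** * Separating families and vanishing point masses *)

Section PointMasses.
Context {R : realType} {d : measure_display} {T : measurableType d}.

(** The family consists of preimages of interiors of balls with centre in the dense set and radius
    [1 / (k + 1)]. If [f x] and [f y] have disjoint balls, a small enough ball around a centre near
    [f x] contains [f x] but not [f y]. Interiors are taken because balls need not be open; the
    injection [g] makes each union range over at most one centre. *)
Lemma standard_borel_separating : standard_borel R T ->
  exists C : nat -> set T, (forall n, measurable (C n)) /\ separating C.
Proof.
move=> [E [f [hE [D cD dD] bij_f mE]]].
have /countable_injP[g injg] := cD.
pose e (k : nat) : R := k.+1%:R^-1.
have e0 k : 0 < e k by rewrite invr_gt0.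
pose O i k : set E := \bigcup_(z in [set z | D z /\ g z = i]) (ball z (e k))^°.
pose C n := let: (i, k) := odflt (0, 0)%N (unpickle n) in f @^-1` O i k.
have CE i k : C (pickle (i, k)) = f @^-1` O i k by rewrite /C pickleK.
exists C; split.
  move=> n; rewrite /C; case: (odflt _ _) => i k; rewrite mE.
  exists (O i k); last by rewrite setTI.
  by apply: sub_gen_smallest; apply: bigcup_open => z _; exact: open_interior.
move=> x y Cxy; apply/(bij_inj bij_f)/eqP; apply: contrapT => /negP fxy.
move: hE; rewrite ball_hausdorff => /(_ _ _ fxy)[[r1 r2]/= /eqP r12].
have r10 : 0 < r1%:num / 2 by [].
have [k ] := ltr_add_invr r10; rewrite add0r -/(e k) => ek.
have ek2 : 0 < e k / 2 by rewrite divr_gt0.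
have [|z [zx Dz]] := dD (ball (f x) (e k / 2))^° _ (@open_interior _ _).
  by exists (f x); exact: nbhsx_ballx.
have xz : ball (f x) (e k / 2) z by exact: interior_subset zx.
have : C (pickle (g z, k)) x.
  rewrite CE; exists z => //; rewrite /=; apply: filterS (nbhsx_ballx _ _ ek2) .
  by move=> u; exact: ball_splitr xz.
move=> /Cxy; rewrite CE => -[z' [Dz' gz]].
have <- : z = z' by apply: injg; rewrite ?inE.
move=> /interior_subset zy.
suff : (ball (f x) r1%:num `&` ball (f y) r2%:num) (f y) by rewrite r12.
split; last exact: ballxx.
apply: le_ball (ball_triangle xz zy).
by have := ltW ek; have := e0 k; lra.
Qed.

Lemma separating_measurable1 (C : nat -> set T) (w : T) :
  (forall n, measurable (C n)) -> separating C -> measurable [set w].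
Proof.
move=> mC sepC.
rewrite (_ : [set w] = \bigcap_n (if `[< C n w >] then C n else ~` C n)).
  apply: bigcap_measurable => [|n _]; first by exists 0%N.
  by case: ifP => _ //; exact: measurableC.
apply/seteqP; split=> [_ -> n _|y Cy /=]; first by case: ifPn => /asboolP.
apply: sepC => n; have := Cy n I; by case: ifPn => /asboolP.
Qed.

Lemma atomless_set1 (P : probability T R) w : measurable [set w] ->
  atomless P -> P [set w] = 0%E.
Proof.
move=> mw aP; apply/eqP; rewrite eq_le measure_ge0 andbT leNgt; apply/negP.
move=> /(aP _ mw)[B [_ Bw B0 BP]].
have [Bw1|Bw0] := pselect (B w).
  move: BP; suff -> : B = [set w] by rewrite ltxx.
  by apply/seteqP; split => // _ ->.
move: B0; suff -> : B = set0 by rewrite measure0 ltxx.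
by apply/seteqP; split => // x Bx; have := Bw _ Bx => /= xw; rewrite xw in Bx.
Qed.

(** The mass of a point is the mean of its conditional masses given [W], and each of those is
    zero. *)
Lemma atomless_cond_set1 (P : probability T R) (W : {mfun T >-> R}) w :
  (forall w, 0 < W w) -> atomless_cond_distribution P W ->
  measurable [set w] -> P [set w] = 0%E.
Proof.
move=> W0 [K [aK hK]] mw; have [_ [g [mg ig gP] KgE]] := hK _ mw.
have /gP : g_sigma_algebra_preimage W setT by exists setT => //; rewrite setTI.
rewrite setIT => <-.
rewrite -[RHS](integral0 P setT).
have mg' : measurable_fun setT (EFin \o g) by exact: measurable_int ig.
apply: ae_eq_integral => //.
apply: filterS KgE => v /= Kv _.
by rewrite -Kv atomless_set1 //; exact: aK.
Qed.

End PointMasses.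

(** * Compactness of sets of densities *)

Section Compactness.
Context {R : realType} {d : measure_display} {T : measurableType d}.
Context (P : probability T R).
Implicit Types Z f g : T -> R.

Lemma measurable_fun_limn_einf (f_ : (T -> \bar R)^nat) :
  (forall n, measurable_fun setT (f_ n)) ->
  measurable_fun setT (fun w => limn_einf (fun n => f_ n w)).
Proof.
move=> mf_.
rewrite (_ : (fun w => _) = (fun w => - limn_esup (fun n => - f_ n w))%E).
  apply: measurableT_comp => //; apply: measurable_fun_limn_esup => n.
  exact: measurableT_comp.
by apply/funext => w; rewrite -limn_einfN; congr limn_einf; apply/funext => n;
  rewrite /= oppeK.
Qed.

Lemma limn_einf_ge0 (u : (\bar R)^nat) :
  (forall n, 0 <= u n)%E -> (0 <= limn_einf u)%E.
Proof.
move=> u0; rewrite limn_einf_lim; apply: lime_ge; first exact: is_cvg_einfs.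
by apply: nearW => n; apply: le_ereal_inf_tmp => _ [k _ <-].
Qed.

Lemma fatou_einf_le (f_ : (T -> \bar R)^nat) (c : \bar R) :
  (forall n, measurable_fun setT (f_ n)) -> (forall n w, 0 <= f_ n w)%E ->
  (forall n, \int[P]_w f_ n w <= c)%E ->
  (\int[P]_w limn_einf (fun n => f_ n w) <= c)%E.
Proof.
move=> mf_ f_0 f_c; apply: le_trans (fatou _ _ _ _) _ => //.
rewrite limn_einf_lim; apply: lime_le; first exact: is_cvg_einfs.
apply: nearW => n; apply: le_trans (f_c n).
by apply: ereal_inf_lbound; exists n => /=.
Qed.

Lemma fatou_le (f_ : (T -> R)^nat) f (c : R) :
  (forall n, measurable_fun setT (f_ n)) -> measurable_fun setT f ->
  (forall n w, 0 <= f_ n w) -> (forall w, 0 <= f w) ->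
  (\forall w \ae P, f_ n w @[n --> \oo] --> f w) ->
  (forall n, \int[P]_w (f_ n w)%:E <= c%:E)%E ->
  (\int[P]_w (f w)%:E <= c%:E)%E.
Proof.
move=> mf_ mf f_0 f0 f_f f_c.
have mEf_ n : measurable_fun setT (fun w => (f_ n w)%:E) by exact/measurable_EFinP.
apply: (@le_trans _ _ (\int[P]_w limn_einf (fun n => (f_ n w)%:E))%E).
  apply: ae_ge0_le_integral => //.
  - by move=> w _; rewrite lee_fin.
  - exact/measurable_EFinP.
  - by move=> w _; apply: limn_einf_ge0 => n; rewrite lee_fin.
  - exact: measurable_fun_limn_einf.
  apply: filterS f_f => w fw _.
  have fwE : (f_ n w)%:E @[n --> \oo] --> (f w)%:E by apply: cvg_EFin => //; exact: nearW.
  by rewrite (cvg_limn_einf_sup fwE).1.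
by apply: fatou_einf_le => // n w; rewrite lee_fin.
Qed.

(** The bounds sum to [c], so the sum of absolute values is integrable and therefore finite almost
    everywhere. *)
Lemma ae_cvg_series (d_ : (T -> R)^nat) (c : R) :
  (forall n, measurable_fun setT (d_ n)) ->
  (forall n, \int[P]_w (`|d_ n w|)%:E <= (c / (2 ^ n.+1)%:R)%:E)%E ->
  \forall w \ae P, cvgn [normed series (fun n => d_ n w)].
Proof.
move=> md dc.
have mEd n : measurable_fun setT (fun w => (`|d_ n w|)%:E).
  by apply/measurable_EFinP/measurableT_comp.
have d0 n w : (0 <= (`|d_ n w|)%:E)%E by rewrite lee_fin.
have c0 : 0 <= c.
  have := dc 0%N; have := @integral_ge0 _ _ _ P setT _ (fun w _ => d0 0%N w).
  by move=> /le_trans /[apply]; rewrite lee_fin expn1 pmulr_lge0.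
have mS : measurable_fun setT (fun w => \sum_(0 <= n <oo) (`|d_ n w|)%:E)%E.
  by apply: ge0_emeasurable_sum.
have S0 w : (0 <= \sum_(0 <= n <oo) (`|d_ n w|)%:E)%E by apply: nneseries_ge0.
have iS : P.-integrable setT (fun w => \sum_(0 <= n <oo) (`|d_ n w|)%:E)%E.
  apply/integrableP; split => //.
  under eq_integral do rewrite gee0_abs //.
  rewrite integral_nneseries //; apply: le_lt_trans (ltry c).
  apply: le_trans (epsilon_trick0 xpredT c0).
  by apply: lee_nneseries => [n _ _|n _]; [apply: integral_ge0|apply: dc].
apply: filterS (integrable_ae measurableT iS) => w /(_ I) fS.
apply: nondecreasing_is_cvgn.
  by apply: nondecreasing_series => n _ _ /=; exact: normr_ge0.
exists (fine (\sum_(0 <= n <oo) (`|d_ n w|)%:E)%E) => _ [n _ <-].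
rewrite -lee_fin fineK // -sumEFin.
by apply: (nneseries_lim_ge n) => k _ _; exact: d0.
Qed.


(* A bounded, strictly convex functional of a density; its near minimizers on  *)
(* a decreasing sequence of convex sets form a Cauchy sequence.                *)
Let phi Z : T -> R := fun w => (1 + Z w)^-1.
Let Phi Z : R := fine (\int[P]_w (phi Z w)%:E)%E.

Let density_like Z := measurable_fun setT Z /\ forall w, 0 <= Z w.

Let phi01 Z w : 0 <= Z w -> 0 < phi Z w <= 1.
Proof.
move=> Zw; have Z1 : 0 < 1 + Z w by lra.
by rewrite /phi invr_gt0 Z1 invf_le1 //; lra.
Qed.

Let measurable_phi Z : density_like Z -> measurable_fun setT (phi Z).
Proof.
move=> [mZ Z0]; rewrite (_ : phi Z = (fun z : R => (1 + Num.max 0 z)^-1) \o Z).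
  apply: measurableT_comp => //; apply: nonincreasing_measurable => // x y xy.
  have x0 : 0 < 1 + Num.max 0 x by rewrite ltr_pwDl // le_max lexx.
  have y0 : 0 < 1 + Num.max 0 y by rewrite ltr_pwDl // le_max lexx.
  by rewrite lef_pV2 ?posrE // lerD2l ge_max !le_max lexx /= xy orbT.
by apply/funext => w; rewrite /phi /= max_r.
Qed.

Let PhiE Z : density_like Z -> (\int[P]_w (phi Z w)%:E = (Phi Z)%:E)%E.
Proof.
move=> dZ; rewrite /Phi fineK // ge0_fin_numE; last first.
  by apply: integral_ge0 => w _; rewrite lee_fin ltW // (andP (phi01 (dZ.2 w))).1.
apply: (@le_lt_trans _ _ (\int[P]_w (cst 1%E w))%E); last first.
  rewrite integral_cst // mul1e; exact: (le_lt_trans (probability_le1 P measurableT) (ltry 1)).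
apply: ge0_le_integral => //.
- by move=> w _; rewrite lee_fin ltW // (andP (phi01 (dZ.2 w))).1.
- exact/measurable_EFinP/measurable_phi.
- by move=> w _; rewrite lee_fin (andP (phi01 (dZ.2 w))).2.
Qed.

Let Phi_ge0 Z : density_like Z -> 0 <= Phi Z.
Proof.
move=> dZ; apply: fine_ge0; apply: integral_ge0 => w _.
by rewrite lee_fin ltW // (andP (phi01 (dZ.2 w))).1.
Qed.

Let mid Z Z' : T -> R := fun w => (Z w + Z' w) / 2.

Let density_like_mid Z Z' : density_like Z -> density_like Z' ->
  density_like (mid Z Z').
Proof.
move=> [mZ Z0] [mZ' Z'0]; split=> [|w]; last by rewrite /mid divr_ge0 // addr_ge0.
by apply: measurable_funM => //; apply: measurable_funD.
Qed.

(** Quantitative strict convexity of [1 / (1 + z)]: the midpoint gap controls the squared difference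
    of the values. *)
Let phi_gap (a b : R) : 0 <= a -> 0 <= b ->
  4^-1 * ((1 + a)^-1 - (1 + b)^-1) ^+ 2 + (1 + (a + b) / 2)^-1
    <= 2^-1 * (1 + a)^-1 + 2^-1 * (1 + b)^-1.
Proof.
move=> a0 b0.
have a1 : 0 < 1 + a by lra.
have b1 : 0 < 1 + b by lra.
have c1 : 0 < 2 + a + b by lra.
rewrite -subr_ge0.
rewrite [leRHS](_ : _ = (a - b) ^+ 2 * (2 * (1 + a) * (1 + b) - (2 + a + b))
    / (4 * ((1 + a) * (1 + b)) ^+ 2 * (2 + a + b))); last first.
  by field; rewrite !gt_eqF //; lra.
have ab0 := mulr_ge0 a0 b0.
apply: divr_ge0; last first.
  by rewrite mulr_ge0 ?ltW // mulr_gt0 // exprn_gt0 // mulr_gt0.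
by rewrite mulr_ge0 ?sqr_ge0 //; nra.
Qed.

(** Integrated form of [phi_gap]: two near minimizers whose midpoint cannot do much better have
    [phi] close in [L^2]. *)
Let Phi_gap Z Z' (a e : R) : density_like Z -> density_like Z' ->
  Phi Z <= a + e -> Phi Z' <= a + e -> a - e <= Phi (mid Z Z') ->
  (\int[P]_w ((phi Z w - phi Z' w) ^+ 2)%:E <= (8 * e)%:E)%E.
Proof.
move=> dZ dZ' Ze Z'e me.
have dm := density_like_mid dZ dZ'.
have mZ := measurable_phi dZ; have mZ' := measurable_phi dZ'.
have mm := measurable_phi dm.
have phi_ge0 Y w : density_like Y -> (0 <= (phi Y w)%:E)%E.
  by move=> dY; rewrite lee_fin ltW // (andP (phi01 (dY.2 w))).1.
have msq : measurable_fun setT (fun w => ((phi Z w - phi Z' w) ^+ 2)%:E).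
  by apply/measurable_EFinP/measurable_funX/measurable_funB.
have gap : (\int[P]_w ((4^-1)%:E * ((phi Z w - phi Z' w) ^+ 2)%:E + (phi (mid Z Z') w)%:E)
    <= \int[P]_w ((2^-1)%:E * (phi Z w)%:E + (2^-1)%:E * (phi Z' w)%:E))%E.
  apply: ge0_le_integral => //.
  - by move=> w _; rewrite adde_ge0 ?phi_ge0 // lee_fin mulr_ge0 ?sqr_ge0.
  - by apply: emeasurable_funD; [exact: measurable_funeM|exact/measurable_EFinP].
  - by apply: emeasurable_funD; apply: measurable_funeM; exact/measurable_EFinP.
  - by move=> w _; rewrite lee_fin; apply: phi_gap; [exact: dZ.2|exact: dZ'.2].
move: gap; rewrite !ge0_integralD //; first last.
all: try by move=> w _; rewrite lee_fin mulr_ge0 ?sqr_ge0 // -lee_fin phi_ge0.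
all: try by move=> w _; exact: phi_ge0.
all: try by apply: measurable_funeM => //; exact/measurable_EFinP.
all: try exact/measurable_EFinP.
rewrite !ge0_integralZl_EFin //.
all: try by move=> w _; rewrite lee_fin ?sqr_ge0 // -lee_fin phi_ge0.
all: try exact/measurable_EFinP.
rewrite !PhiE //.
have : (0 <= \int[P]_w ((phi Z w - phi Z' w) ^+ 2)%:E)%E.
  by apply: integral_ge0 => w _; rewrite lee_fin sqr_ge0.
case: (\int[P]_w _)%E => [r| |] //=; last by rewrite gt0_muley // lte_fin.
by rewrite -!EFinM -!EFinD !lee_fin => _; lra.
Qed.


Let ae_cvg_phi0 (Z Z' : (T -> R)^nat) : (forall n, density_like (Z n)) ->
  (forall n, density_like (Z' n)) ->
  (forall n, \int[P]_w ((phi (Z n) w - phi (Z' n) w) ^+ 2)%:E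
       <= (8 * (4 ^+ n)^-1)%:E)%E ->
  \forall w \ae P, cvgn [normed series (fun n => phi (Z n) w - phi (Z' n) w)].
Proof.
(* The estimate below bounds the [n]-th norm by [(1/2 + 8/2) / 2^n = 9 / 2^(n+1)]. *)
move=> dZ dZ' sq; apply: (@ae_cvg_series (fun n w => phi (Z n) w - phi (Z' n) w) 9).
  by move=> n; apply: measurable_funB; exact: measurable_phi.
move=> n; set D := fun w => phi (Z n) w - phi (Z' n) w.
have mD : measurable_fun setT D by apply: measurable_funB; exact: measurable_phi.
have p0 : 0 < (2 : R) ^+ n by rewrite exprn_gt0.
have mD2 : measurable_fun setT (fun w => (D w ^+ 2)%:E).
  by apply/measurable_EFinP/measurable_funX.
(* AM-GM: |D| <= (2^-n + 2^n D^2) / 2 *)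
apply: (@le_trans _ _ (\int[P]_w ((2^-1 * (2 ^+ n)^-1)%:E
    + (2^-1 * 2 ^+ n)%:E * (D w ^+ 2)%:E))%E).
  apply: ge0_le_integral => //.
  - by apply/measurable_EFinP/measurableT_comp.
  - by apply: emeasurable_funD => //; exact: measurable_funeM.
  move=> w _; rewrite lee_fin -real_normK ?num_real //.
  move: (`|D w|) => a.
  have -> : 2^-1 * (2 ^+ n)^-1 + 2^-1 * 2 ^+ n * a ^+ 2 =
      a + 2^-1 * (2 ^+ n) * (a - (2 ^+ n)^-1) ^+ 2.
    by field; rewrite gt_eqF.
  by rewrite lerDl mulr_ge0 ?sqr_ge0 // mulr_ge0 // ltW.
rewrite ge0_integralD //.
all: try exact: measurable_funeM.
all: try by move=> w _; rewrite lee_fin mulr_ge0 ?sqr_ge0 // ?invr_ge0 ?mulr_ge0 // ltW.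
rewrite integral_cst // ge0_integralZl_EFin //.
all: try by rewrite mulr_ge0 // ltW.
all: try by move=> w _; rewrite lee_fin sqr_ge0.
apply: (@le_trans _ _ ((2^-1 * (2 ^+ n)^-1)%:E * 1%:E +
    (2^-1 * 2 ^+ n)%:E * (8 * (4 ^+ n)^-1)%:E)%E).
  apply: leeD.
    by apply: lee_wpmul2l; [rewrite lee_fin mulr_ge0 // invr_ge0 ltW|exact: probability_le1].
  by apply: lee_wpmul2l; [rewrite lee_fin mulr_ge0 // ltW|exact: sq].
rewrite -!EFinM -EFinD lee_fin.
have -> : (4 : R) ^+ n = 2 ^+ n * 2 ^+ n by rewrite -exprMn; congr (_ ^+ _); lra.
rewrite expnS natrM natrX.
suff -> : 2^-1 * (2 ^+ n)^-1 * 1 + 2^-1 * 2 ^+ n * (8 * (2 ^+ n * 2 ^+ n)^-1)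
  = 9 / (2 * 2 ^+ n) :> R by [].
by field; rewrite gt_eqF.
Qed.

Let cvg_of_phi (u : R^nat) (g : R) : (forall n, 0 <= u n) ->
  (1 + u n)^-1 @[n --> \oo] --> g -> g != 0 -> u n @[n --> \oo] --> g^-1 - 1.
Proof.
move=> u0 ug g0.
rewrite (_ : (fun n => u n) = (fun n => ((1 + u n)^-1)^-1 - 1)).
  by apply: cvgB; [exact: cvgV|exact: cvg_cst].
by apply/funext => n; rewrite invrK addrC addKr.
Qed.

Let cvgy_of_phi (u : R^nat) : (forall n, 0 <= u n) ->
  (1 + u n)^-1 @[n --> \oo] --> (0 : R) -> limn_einf (fun n => (u n)%:E) = +oo%E.
Proof.
move=> u0 ug.
have uy : (u n)%:E @[n --> \oo] --> +oo%E.
  apply/cvgeryP/cvgryPge => A.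
  have e0 : 0 < (1 + Num.max 0 A)^-1.
    by rewrite invr_gt0 ltr_pwDl // le_max lexx.
  have /cvgrPdist_lt /(_ _ e0) := ug; apply: filterS => n /=.
  have u1 : 0 < 1 + u n by rewrite ltr_pwDl.
  rewrite sub0r normrN gtr0_norm ?invr_gt0 // ltf_pV2 ?posrE //; last first.
    by rewrite -invr_gt0.
  by rewrite ltrD2l => /ltW; apply: le_trans; rewrite le_max lexx orbT.
by rewrite (cvg_limn_einf_sup uy).1.
Qed.

(** [I] may be uncountable, while the limit density is built from the countably many constraints in
    the lists [G n]. Any further constraint [i] is recovered at the end: near minimizers that also
    satisfy [i] are forced to the same limit. *)
Theorem convex_constraints_compact (D : set (T -> R)) (I : Type)
    (h : I -> T -> R) (al : R) :
  (forall Z, D Z -> [/\ measurable_fun setT Z, forall w, 0 <= Z w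
                      & (\int[P]_w (Z w)%:E <= 1)%E]) ->
  (forall Z Z', D Z -> D Z' -> D (fun w => (Z w + Z' w) / 2)) ->
  (forall (Z_ : (T -> R)^nat) Z, (forall n, D (Z_ n)) -> measurable_fun setT Z ->
     (forall w, 0 <= Z w) -> (\forall w \ae P, Z_ n w @[n --> \oo] --> Z w) ->
     D Z) ->
  (forall i, measurable_fun setT (h i)) -> (forall i w, 0 <= h i w) ->
  (forall F : seq I, exists2 Z, D Z &
     forall i, List.In i F -> (\int[P]_w (h i w * Z w)%:E <= al%:E)%E) ->
  exists2 Z, D Z & forall i, (\int[P]_w (h i w * Z w)%:E <= al%:E)%E.
Proof.
move=> Ddens Dmid Dclosed mh h0 fip.
have dD Z : D Z -> density_like Z by move=> /Ddens[].
pose C (F : seq I) := [set Z | D Z /\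
  forall i, List.In i F -> (\int[P]_w (h i w * Z w)%:E <= al%:E)%E].
have Cmid F Z Z' : C F Z -> C F Z' -> C F (mid Z Z').
  move=> [DZ CZ] [DZ' CZ']; split; first exact: Dmid.
  move=> i Fi; have [mZ Z0 _] := Ddens _ DZ; have [mZ' Z'0 _] := Ddens _ DZ'.
  have -> : (\int[P]_w (h i w * mid Z Z' w)%:E =
      \int[P]_w ((2^-1)%:E * (h i w * Z w)%:E + (2^-1)%:E * (h i w * Z' w)%:E))%E.
    by apply: eq_integral => w _; rewrite -!EFinM -EFinD /mid; congr (_%:E); field.
  have mhZ Y : measurable_fun setT Y -> measurable_fun setT (fun w => (h i w * Y w)%:E).
    by move=> mY; apply/measurable_EFinP/measurable_funM.
  rewrite ge0_integralD //.
  all: try by apply: measurable_funeM; exact: mhZ.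
  all: try by move=> w _; rewrite lee_fin !mulr_ge0.
  rewrite !ge0_integralZl_EFin //.
  all: try exact: mhZ.
  all: try by move=> w _; rewrite lee_fin !mulr_ge0.
  have -> : (al%:E = (2^-1)%:E * al%:E + (2^-1)%:E * al%:E)%E.
    by rewrite -!EFinM -EFinD; congr (_%:E); field.
  by apply: leeD; apply: lee_wpmul2l; rewrite ?lee_fin //; [exact: CZ|exact: CZ'].
pose V F := [set Phi Z | Z in C F].
have infV F : has_inf (V F).
  have [Z DZ CZ] := fip F; split; first by exists (Phi Z), Z.
  by exists 0 => _ [Y [DY _] <-]; exact/Phi_ge0/dD.
pose a F := inf (V F).
have aP F Z : C F Z -> a F <= Phi Z.
  by move=> CZ; apply: ge_inf; [exact: (infV F).2|exists Z].
have Phi1 Z : D Z -> Phi Z <= 1.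
  move=> /dD dZ; rewrite -lee_fin -PhiE //.
  apply: (@le_trans _ _ (\int[P]_w (cst 1%E w))%E); last first.
    by rewrite integral_cst // mul1e; exact: probability_le1.
  apply: ge0_le_integral => //.
  - by move=> w _; rewrite lee_fin ltW // (andP (phi01 (dZ.2 w))).1.
  - exact/measurable_EFinP/measurable_phi.
  - by move=> w _; rewrite lee_fin (andP (phi01 (dZ.2 w))).2.
have supa : has_sup [set a F | F in setT].
  split; first by exists (a [::]), [::].
  exists 1 => _ [F _ <-]; have [Z DZ CZ] := fip F.
  by apply: le_trans (Phi1 _ DZ); apply: aP.
(* The value [A] bounds [a F] for every finite [F], so near minimizers for [i :: G n] are compared
   with the same [A] as those for [G n]. *)
pose A := sup [set a F | F in setT].
have aA F : a F <= A by apply: ub_le_sup; [exact: supa.2|exists F].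
pose e n : R := (4 ^+ n)^-1.
have e0 n : 0 < e n by rewrite invr_gt0 exprn_gt0.
have incl (F F' : seq I) : (forall i, List.In i F -> List.In i F') -> C F' `<=` C F.
  by move=> FF Z [DZ CZ]; split => // i Fi; apply/CZ/FF.
have a_le (F F' : seq I) : (forall i, List.In i F -> List.In i F') -> a F <= a F'.
  move=> FF; apply: lb_le_inf; first exact: (infV F').1.
  by move=> _ [Z CZ <-]; apply: aP; exact: incl CZ.
have optimal F n : exists2 Z, C F Z & Phi Z <= A + e n.
  have [_ [Z CZ <-] Zlt] := inf_adherent (e0 n) (infV F).
  by exists Z => //; rewrite (le_trans (ltW Zlt)) // lerD2r aA.
have /choice[Fn FnP] n : exists F, A - e n < a F.
  by have [_ [F _ <-] ?] := sup_adherent (e0 n) supa; exists F.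
pose G := fix G n := if n is n'.+1 then Fn n ++ G n' else Fn 0%N.
have Gn n : A - e n <= a (G n).
  apply: le_trans (ltW (FnP n)) _; apply: a_le => i.
  by case: n => [//|n] Fi; apply/List.in_app_iff; left.
have GS n i : List.In i (G n) -> List.In i (G n.+1).
  by move=> Gi; apply/List.in_app_iff; right.
have close n Z Z' : C (G n) Z -> C (G n) Z' -> Phi Z <= A + e n -> Phi Z' <= A + e n ->
    (\int[P]_w ((phi Z w - phi Z' w) ^+ 2)%:E <= (8 * e n)%:E)%E.
  move=> CZ CZ' Ze Z'e; apply: (Phi_gap (a := A)) => //; [exact: dD CZ.1|exact: dD CZ'.1|].
  by apply: le_trans (Gn n) _; apply/aP/Cmid.
have /choice[Z ZP] n : exists Z, C (G n) Z /\ Phi Z <= A + e n.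
  by have [Z ? ?] := optimal (G n) n; exists Z.
have DZ n : D (Z n) by have [[]] := ZP n.
have eS n : e n.+1 <= e n.
  by rewrite /e exprS lef_pV2 ?posrE ?mulr_gt0 ?exprn_gt0 // ler_peMl ?exprn_ge0 //; lra.
have cauchyZ : \forall w \ae P,
    cvgn [normed series (fun n => phi (Z n.+1) w - phi (Z n) w)].
  apply: (@ae_cvg_phi0 (fun n => Z n.+1)) => n; [exact: dD|exact: dD|].
  apply: close; [|exact: (ZP n).1| |exact: (ZP n).2].
    exact: incl (GS n) _ (ZP n.+1).1.
  by apply: le_trans (ZP n.+1).2 _; rewrite lerD2l.
(* Defined everywhere so that it is measurable; [fine] puts 0 at infinite values, which occur only
   on a null set. *)
pose Zl w := fine (limn_esup (fun n => (Z n w)%:E)).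
have mEZ n : measurable_fun setT (fun w => (Z n w)%:E).
  by apply/measurable_EFinP; exact: (dD _ (DZ n)).1.
have mZl : measurable_fun setT Zl.
  apply: (measurableT_comp (fine_measurable measurableT)).
  exact: measurable_fun_limn_esup.
have Zl0 w : 0 <= Zl w.
  rewrite fine_ge0 // limn_esup_lim; apply: lime_ge; first exact: is_cvg_esups.
  apply: nearW => n; apply: le_ereal_sup_tmp; exists (Z n w)%:E; first by exists n => /=.
  by rewrite lee_fin; exact: (dD _ (DZ n)).2.
(* By Fatou the lower limit has mass at most 1. This excludes a limit 0 of [phi (Z n)], that is,
   densities escaping to infinity. *)
have einf_fin : \forall w \ae P, limn_einf (fun n => (Z n w)%:E) != +oo%E.
  have ge0 w : (0 <= limn_einf (fun n => (Z n w)%:E))%E.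
    by apply: limn_einf_ge0 => n; rewrite lee_fin; exact: (dD _ (DZ n)).2.
  have : P.-integrable setT (fun w => limn_einf (fun n => (Z n w)%:E)).
    apply/integrableP; split; first exact: measurable_fun_limn_einf.
    under eq_integral do rewrite gee0_abs //.
    apply: le_lt_trans (ltry 1); apply: fatou_einf_le => // n.
      by move=> w; rewrite lee_fin; exact: (dD _ (DZ n)).2.
    by have [] := Ddens _ (DZ n).
  move=> /(integrable_ae measurableT); apply: filterS => w /(_ Logic.I).
  by rewrite fin_numE => /andP[].
have cvgZ : \forall w \ae P, exists2 g : R, g != 0 &
    phi (Z n) w @[n --> \oo] --> g /\ g^-1 - 1 = Zl w.
  apply: filterS2 cauchyZ einf_fin => w cw fw.
  have cphi : cvgn (fun n => phi (Z n) w).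
    rewrite (_ : (fun n => _) = (fun n => phi (Z 0%N) w +
        series (telescope (fun n => phi (Z n) w)) n)).
      by apply: is_cvgD; [exact: is_cvg_cst|exact: normed_cvg cw].
    by apply/funext => n; rewrite -(eq_sum_telescope (fun n => phi (Z n) w)).
  have g0 : limn (fun n => phi (Z n) w) != 0.
    apply: contra fw => /eqP l0; rewrite cvgy_of_phi // => [n|].
      exact: (dD _ (DZ n)).2.
    by rewrite -l0; exact: cphi.
  exists (limn (fun n => phi (Z n) w)) => //; split; first exact: cphi.
  have := cvg_of_phi (fun n => (dD _ (DZ n)).2 w) cphi g0.
  move=> cZ.
  have cZE : (Z n w)%:E @[n --> \oo] --> ((limn (fun n => phi (Z n) w))^-1 - 1)%:E.
    by apply: cvg_EFin => //; exact: nearW.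
  by rewrite /Zl (cvg_limn_einf_sup cZE).2.
exists Zl.
  apply: (Dclosed Z) => //; apply: filterS cvgZ => w [g g0 [cg <-]].
  by apply: cvg_of_phi => // n; exact: (dD _ (DZ n)).2.
move=> i.
have /choice[Z' Z'P] n : exists Z', C (i :: G n) Z' /\ Phi Z' <= A + e n.
  by have [Z' ? ?] := optimal (i :: G n) n; exists Z'.
have DZ' n : D (Z' n) by have [[]] := Z'P n.
have near : \forall w \ae P,
    cvgn [normed series (fun n => phi (Z n) w - phi (Z' n) w)].
  apply: ae_cvg_phi0 => n; [exact: dD|exact: dD|].
  apply: close; [exact: (ZP n).1| |exact: (ZP n).2|exact: (Z'P n).2].
  by apply: incl (Z'P n).1 => j; right.
apply: (@fatou_le (fun n w => h i w * Z' n w)) => //.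
- by move=> n; apply: measurable_funM => //; exact: (dD _ (DZ' n)).1.
- exact: measurable_funM.
- by move=> n w; rewrite mulr_ge0 //; exact: (dD _ (DZ' n)).2.
- by move=> w; rewrite mulr_ge0.
- apply: filterS2 cvgZ near => w [g g0 [cg gE]] /normed_cvg/cvg_series_cvg_0 cd.
  apply: cvgM; first exact: cvg_cst.
  rewrite -gE; apply: cvg_of_phi => //; first by move=> n; exact: (dD _ (DZ' n)).2.
  rewrite (_ : (fun n => _) =
      (fun n => phi (Z n) w - (phi (Z n) w - phi (Z' n) w))).
    by rewrite -[g]subr0; exact: cvgB.
  by apply/funext => n; rewrite subKr.
- by move=> n; apply: (Z'P n).1.2; left.
Qed.

End Compactness.

(** * Truncated concavification *)

Section TruncatedConcavification.
Context {R : realType}.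
Context (U : R -> R) (U_nd : nondecreasing_on_nneg U).

Let Uc k := concavification (truncation U k).

Lemma truncation_le k k' y : 0 < k -> k <= k' -> 0 <= y ->
  truncation U k y <= truncation U k' y.
Proof.
move=> k0 kk y0; apply: U_nd; first by rewrite le_min y0 ltW.
by rewrite le_min ge_min lexx /= ge_min kk orbT.
Qed.

Lemma truncation_ge k y : 0 < k -> 0 <= y -> U 0 <= truncation U k y.
Proof. by move=> k0 y0; apply: U_nd => //; rewrite le_min y0 ltW. Qed.

Lemma truncation_le_id k y : 0 < k -> 0 <= y -> truncation U k y <= U y.
Proof.
by move=> k0 y0; apply: U_nd; rewrite ?ge_min ?lexx // le_min y0 ltW.
Qed.

Lemma truncation_concavificationP k : 0 < k ->
  concave_majorant (truncation U k) (Uc k) /\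
  (forall g, concave_majorant (truncation U k) g ->
     forall y, 0 <= y -> Uc k y <= g y).
Proof.
by move=> k0; apply: concavificationP; exact: truncation_concave_majorant.
Qed.

Lemma concavification_ge k y : 0 < k -> 0 <= y -> truncation U k y <= Uc k y.
Proof. by move=> /truncation_concavificationP[[_ +] _]; exact. Qed.

Lemma concavification_geU0 k y : 0 < k -> 0 <= y -> U 0 <= Uc k y.
Proof.
by move=> k0 y0; apply: le_trans (concavification_ge _ _) => //; exact: truncation_ge.
Qed.

Lemma concavification_concave k t y z : 0 < k -> 0 <= t <= 1 -> 0 <= y -> 0 <= z ->
  t * Uc k y + (1 - t) * Uc k z <= Uc k (t * y + (1 - t) * z).
Proof. by move=> /truncation_concavificationP[[/concave_on_nnegP +] _] _; exact. Qed.

Lemma concavification_le_affine k a b y : 0 < k ->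
  (forall z, 0 <= z -> truncation U k z <= a + b * z) -> 0 <= y ->
  Uc k y <= a + b * y.
Proof.
move=> /truncation_concavificationP[_ h] ab y0.
exact: h (affine_concave_majorant ab) _ y0.
Qed.

Lemma concavification_leW k k' y : 0 < k -> k <= k' -> 0 <= y -> Uc k y <= Uc k' y.
Proof.
move=> k0 kk y0; have k'0 : 0 < k' by exact: lt_le_trans kk.
apply: (truncation_concavificationP k0).2 => //.
have [[cc maj] _] := truncation_concavificationP k'0; split => // z z0.
by apply: le_trans (maj _ z0); exact: truncation_le.
Qed.

(** A concave function that is bounded below on a half-line cannot decrease. *)
Lemma concavification_nd k y z : 0 < k -> 0 <= y -> y <= z -> Uc k y <= Uc k z.
Proof.
move=> k0 y0 yz; have z0 : 0 <= z by exact: le_trans yz.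
have y1 := concavification_geU0 k0 y0.
apply/ler_addgt0Pr => e e0; pose s := e / (e + (Uc k y - U 0)).
have d0 : 0 < e + (Uc k y - U 0) by rewrite ltr_pwDl // subr_ge0.
have s0 : 0 < s by rewrite divr_gt0.
have s1 : s <= 1 by rewrite ler_pdivrMr // mul1r lerDl subr_ge0.
(* concavity between y and the far point u, where Uc k u >= U 0 *)
pose u := y + (z - y) / s.
have u0 : 0 <= u by rewrite addr_ge0 // divr_ge0 ?subr_ge0 // ltW.
have zE : (1 - s) * y + (1 - (1 - s)) * u = z by rewrite /u; field; rewrite gt_eqF.
have := @concavification_concave k (1 - s) y u k0.
rewrite zE => /(_ _ y0 u0) h.
have {}h := h _; have s01 : 0 <= 1 - s <= 1 by lra.
have {h} := h s01.
have uU := concavification_geU0 k0 u0.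
have sE : s * (e + (Uc k y - U 0)) = e by rewrite /s divfK // gt_eqF.
have := mulr_ge0 (ltW s0) (ltW e0).
have : 0 <= s * (Uc k u - U 0) by rewrite mulr_ge0 ?subr_ge0 // ltW.
move: sE; nra.
Qed.

Lemma concavification_le_sublinear k y : sublinear U -> 0 < k -> 0 <= y ->
  Uc k y <= concavification U y.
Proof.
move=> U_sub k0 y0; apply: (truncation_concavificationP k0).2 => //.
have [[cc maj] _] := concavificationP (sublinear_concave_majorant U_nd U_sub).
by split => // z z0; apply: le_trans (maj _ z0); exact: truncation_le_id.
Qed.

Lemma concavification_lt_right k y c : 0 < k -> 0 < y -> Uc k y < c ->
  exists2 q : rat, y < ratr q & Uc k (ratr q) < c.
Proof.
move=> k0 y0 yc; pose D := Uc k y - U 0.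
have D0 : 0 <= D by rewrite subr_ge0 concavification_geU0 // ltW.
(* Concavity between 0 and [z] gives [y * Uc k z <= y * Uc k y + (z - y) * D], which is below
   [y * c] once [z - y < h]. *)
pose h := y * (c - Uc k y) / (D + 1).
have D1 : 0 < D + 1 by rewrite ltr_wpDl.
have h0 : 0 < h by rewrite divr_gt0 // mulr_gt0 // subr_gt0.
have [q] := rat_in_itvoo (ltr_pwDr h0 (lexx y)).
rewrite in_itv /= => /andP[yq qh]; exists q => //.
set z := ratr q in yq qh *; have z0 : 0 < z by exact: lt_trans yq.
have t01 : 0 <= y / z <= 1 by rewrite ler_pdivrMr // mul1r divr_ge0 ltW.
have := @concavification_concave k (y / z) z 0 k0 t01 (ltW z0) (lexx 0).
rewrite mulr0 addr0 divfK ?gt_eqF // => cc.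
have U0 : U 0 <= Uc k 0 by exact: concavification_geU0.
have cc' : Uc k z * y + (z - y) * Uc k 0 <= z * Uc k y.
  have := ler_wpM2r (ltW z0) cc; rewrite mulrDl.
  have -> : y / z * Uc k z * z = Uc k z * y by field; rewrite gt_eqF.
  have -> : (1 - y / z) * Uc k 0 * z = (z - y) * Uc k 0 by field; rewrite gt_eqF.
  by rewrite [leRHS]mulrC.
have hE : h * (D + 1) = y * (c - Uc k y) by rewrite /h divfK // gt_eqF.
have zy : z - y < h by lra.
rewrite -(ltr_pM2r y0).
have : (z - y) * D <= (z - y) * (D + 1) by rewrite ler_wpM2l ?subr_ge0 ?lerDl // ltW.
have : (z - y) * (D + 1) < h * (D + 1) by rewrite ltr_pM2r.
have : 0 <= (z - y) * (Uc k 0 - U 0) by rewrite mulr_ge0 ?subr_ge0 // ltW.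
move: hE; rewrite /D; nra.
Qed.

Context {d : measure_display} {T : measurableType d}.

Lemma measurable_nondecreasing_comp (X : T -> R) :
  measurable_fun setT X -> (forall w, 0 <= X w) -> measurable_fun setT (U \o X).
Proof.
move=> mX X0; rewrite (_ : U \o X = (fun y => U (Num.max 0 y)) \o X).
  apply: measurableT_comp => //; apply: nondecreasing_measurable => // x y xy.
  apply: U_nd; first by rewrite le_max lexx.
  by rewrite ge_max !le_max lexx xy orbT.
by apply/funext => w /=; rewrite max_r.
Qed.

Lemma measurable_truncation (W X : T -> R) :
  measurable_fun setT W -> measurable_fun setT X ->
  (forall w, 0 < W w) -> (forall w, 0 <= X w) ->
  measurable_fun setT (fun w => truncation U (W w) (X w)).
Proof.
move=> mW mX W0 X0; apply: measurable_nondecreasing_comp.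
  exact: measurable_minr.
by move=> w; rewrite le_min X0 ltW.
Qed.

(** At a fixed level the value is monotone in the cap, hence measurable in [W]. Monotonicity in the
    level and [concavification_lt_right] then write a sublevel set as a countable union over
    rational levels above [X]; that lemma covers positive levels only, so [X w = 0] is treated
    apart. *)
Lemma measurable_concavification (W X : T -> R) :
  measurable_fun setT W -> measurable_fun setT X ->
  (forall w, 0 < W w) -> (forall w, 0 <= X w) ->
  measurable_fun setT (fun w => Uc (W w) (X w)).
Proof.
move=> mW mX W0 X0.
have mUc q : 0 <= q -> measurable_fun setT (fun w => Uc (W w) q).
  move=> q0; rewrite (_ : (fun w => _) =
      (fun k => if 0 < k then Uc k q else U 0) \o W).
    apply: measurableT_comp => //; apply: nondecreasing_measurable => // k k' kk.
    case: ifPn => k0; case: ifPn => k'0 //.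
    - exact: concavification_leW.
    - by move: k'0; rewrite (lt_le_trans k0 kk).
    - exact: concavification_geU0.
  by apply/funext => w /=; rewrite W0.
apply: (measurability _ (RGenInftyO.measurableE R)) => //.
move=> _ [_ [c ->] <-].
rewrite setTI (_ : _ @^-1` _ = ([set w | X w = 0] `&` [set w | Uc (W w) 0 < c]) `|`
   \bigcup_(q : rat) ([set w | X w < ratr q] `&`
     [set w | Uc (W w) (Num.max 0 (ratr q)) < c])).
  have mlt (f : T -> R) (b : R) : measurable_fun setT f -> measurable [set w | f w < b].
    move=> mf; rewrite -[X in measurable X]setTI.
    rewrite (_ : [set w | f w < b] = f @^-1` `]-oo, b[%classic).
      exact: mf.
    by apply/seteqP; split => w /=; rewrite in_itv.
  apply: measurableU.
    apply: measurableI; last exact/mlt/mUc.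
    rewrite -[X in measurable X]setTI (_ : [set w | X w = 0] = X @^-1` [set 0]) //.
    exact: mX.
  apply: bigcupT_measurable_rat => q.
  by apply: measurableI; [exact: mlt|apply/mlt/mUc; rewrite le_max lexx].
apply/seteqP; split=> w /=; rewrite in_itv /=.
  move=> wc; have [Xw|Xw] := eqVneq (X w) 0; first by left; rewrite -Xw.
  have Xw0 : 0 < X w by rewrite lt_neqAle eq_sym Xw X0.
  have [q Xq qc] := concavification_lt_right (W0 w) Xw0 wc.
  by right; exists q => //; split => //=; rewrite max_r // (le_trans (X0 w)) // ltW.
move=> [[-> //]|[q _ /= [Xq]]].
have q0 : 0 <= ratr q :> R by exact: le_trans (ltW Xq).
by rewrite max_r //; apply: le_lt_trans; apply: concavification_nd => //; exact: ltW.
Qed.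

End TruncatedConcavification.

(** * Densities *)

Section Densities.
Local Open Scope charge_scope.
Context {R : realType} {d : measure_display} {T : measurableType d}.
Implicit Types (P Q : probability T R) (QQ : set (probability T R)) (Z : T -> R).

(** A version of [dQ/dP] that is real and nonnegative at every point, which suits pointwise
    arguments. *)
Definition density_of P Q (Z : T -> R) :=
  [/\ measurable_fun setT Z, forall w, 0 <= Z w
    & forall A, measurable A -> (Q A = \int[P]_(w in A) (Z w)%:E)%E].

Lemma dominatesP P Q : Q `<< P <-> forall A, measurable A -> (P A = 0 -> Q A = 0)%E.
Proof. exact: (null_content_dominatesP Q P). Qed.

Lemma density_of_dominates P Q Z : density_of P Q Z -> Q `<< P.
Proof.
move=> [mZ Z0 QZ]; apply/dominatesP => A mA PA; rewrite QZ //.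
by rewrite null_set_integral //; apply/measurable_EFinP/(measurable_funS measurableT).
Qed.

Lemma density_of_ae_eq P Q Z : density_of P Q Z ->
  (EFin \o Z = 'd (charge_of_finite_measure Q) '/d P %[ae P]).
Proof.
move=> dZ; have QP := density_of_dominates dZ; case: dZ => mZ Z0 QZ.
apply: ae_eq_sym; apply: integral_ae_eq => //.
- exact: Radon_Nikodym_integrable.
- exact/measurable_EFinP.
- by move=> A _ mA; rewrite -Radon_Nikodym_integral //= QZ.
Qed.

Lemma ae_eq_density_of P Q Z : Q `<< P -> measurable_fun setT Z ->
  (forall w, 0 <= Z w) ->
  (EFin \o Z = 'd (charge_of_finite_measure Q) '/d P %[ae P]) ->
  density_of P Q Z.
Proof.
move=> QP mZ Z0 ZE; split => // A mA.
rewrite -[LHS]/(charge_of_finite_measure Q A) (Radon_Nikodym_integral (mu := P)) //.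
have mRN := measurable_int _ (Radon_Nikodym_integrable (nu := charge_of_finite_measure Q) QP).
apply: ae_eq_integral => //.
- exact: (measurable_funS measurableT).
- by apply/measurable_EFinP/(measurable_funS measurableT).
- by apply: filterS ZE => w /= ZE _; rewrite -ZE.
Qed.

Lemma density_of_exists P Q : Q `<< P -> exists Z, density_of P Q Z.
Proof.
move=> QP; pose f := Radon_Nikodym_SigmaFinite.f Q P.
have f0 w : (0 <= f w)%E by exact: Radon_Nikodym_SigmaFinite.f_ge0.
have ff w : (fine (f w))%:E = f w.
  by rewrite fineK //; exact: Radon_Nikodym_SigmaFinite.f_fin_num.
exists (fine \o f); split.
- apply: (measurableT_comp (fine_measurable measurableT)).
  exact: measurable_int (Radon_Nikodym_SigmaFinite.f_integrable QP).
- by move=> w; rewrite fine_ge0.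
- move=> A mA; under eq_integral do rewrite /= ff.
  exact: Radon_Nikodym_SigmaFinite.f_integral.
Qed.

Lemma integral_density P Q Z (f : T -> \bar R) : density_of P Q Z ->
  Q.-integrable setT f -> (\int[Q]_w f w = \int[P]_w (f w * (Z w)%:E))%E.
Proof.
move=> dZ intf; have QP := density_of_dominates dZ.
rewrite -(Radon_Nikodym_change_of_variables QP) //.
have mf := measurable_int _ intf.
have mRN := measurable_int _ (Radon_Nikodym_integrable (nu := charge_of_finite_measure Q) QP).
apply: ae_eq_integral => //.
- exact: emeasurable_funM.
- by apply: emeasurable_funM => //; apply/measurable_EFinP; case: dZ.
by apply: filterS (density_of_ae_eq dZ) => w /= ZE _; rewrite -ZE.
Qed.

Lemma ae_cvg_in_probability P (Z_ : {mfun T >-> R}^nat) (Z : {mfun T >-> R}) :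
  (\forall w \ae P, Z_ n w @[n --> \oo] --> Z w) -> cvg_in_probability P Z_ Z.
Proof.
move=> ZZ e e0; pose A n := [set w | e <= `|Z_ n w - Z w|].
have mA n : measurable (A n).
  rewrite /A -[X in measurable X]setTI.
  have mf : measurable_fun setT (fun w => `|Z_ n w - Z w|).
    by apply: measurableT_comp => //; exact: measurable_funB.
  rewrite (_ : [set w | _] = (fun w => `|Z_ n w - Z w|) @^-1` `[e, +oo[%classic).
    exact: mf.
  by apply/seteqP; split => w /=; rewrite in_itv /= andbT.
have [|||||_ _] := @dominated_convergence _ T R P setT measurableT
  (fun n w => (\1_(A n) w)%:E) (cst 0%E) (cst 1%E).
- by move=> n; apply/measurable_EFinP; exact: measurable_indic.
- exact: measurable_cst.
- apply: filterS ZZ => w /cvgrPdist_lt /(_ _ e0) [N _ NZ] _.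
  apply: cvg_near_cst; exists N => // n /NZ /=.
  rewrite distrC indicE => h; rewrite memNset //= /A /=.
  by apply/negP; rewrite -ltNge.
- exact: finite_measure_integrable_cst.
- by apply: aeW => w n _; rewrite lee_fin ger0_norm // indicE; case: (_ \in _).
rewrite integral0 => h; apply: cvg_trans h.
apply: near_eq_cvg; apply: nearW => n /=.
by rewrite integral_indic // setIT.
Qed.

(** Almost sure convergence implies convergence in probability, so closedness in [L^0] yields the
    closure property required by [convex_constraints_compact]. *)
Lemma densities_closed P QQ (Z_ : (T -> R)^nat) (Z : T -> R) :
  (forall Q, QQ Q -> Q `<< P) -> closed_in_L0 P (densities P QQ) ->
  (forall n, exists2 Q, QQ Q & density_of P Q (Z_ n)) ->
  measurable_fun setT Z -> (forall w, 0 <= Z w) ->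
  (\forall w \ae P, Z_ n w @[n --> \oo] --> Z w) ->
  exists2 Q, QQ Q & density_of P Q Z.
Proof.
move=> QP cl ZQ mZ Z0 ZZ.
have mZ_ n : measurable_fun setT (Z_ n) by have [Q _ []] := ZQ n.
pose mf (f : T -> R) (m : measurable_fun setT f) : {mfun T >-> R} :=
  HB.pack f (isMeasurableFun.Build _ _ _ _ f m).
have cvgZ : cvg_in_probability P (fun n => mf _ (mZ_ n)) (mf _ mZ).
  exact: ae_cvg_in_probability.
have [|Q QQQ ZE] := cl _ _ _ cvgZ.
  by move=> n; have [Q QQQ dQ] := ZQ n; exists Q => //; exact: density_of_ae_eq.
by exists Q => //; apply: ae_eq_density_of => //; exact: QP.
Qed.

Lemma densities_convex P QQ (Z1 Z2 : T -> R) (t : R) : convex_probabilities QQ ->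
  0 <= t <= 1 ->
  (exists2 Q, QQ Q & density_of P Q Z1) -> (exists2 Q, QQ Q & density_of P Q Z2) ->
  exists2 Q, QQ Q & density_of P Q (fun w => t * Z1 w + (1 - t) * Z2 w).
Proof.
move=> cQ /[dup] t01 /andP[t0 t1] [Q1 Q1Q [m1 p1 d1]] [Q2 Q2Q [m2 p2 d2]].
have [Q QQQ QE] := cQ _ _ _ Q1Q Q2Q t01; exists Q => //.
have t1' : 0 <= 1 - t by rewrite subr_ge0.
split=> [|w|A mA].
- by apply: measurable_funD; apply: measurable_funM.
- by rewrite addr_ge0 // mulr_ge0.
have mA1 := measurable_funS measurableT (@subsetT _ A) m1.
have mA2 := measurable_funS measurableT (@subsetT _ A) m2.
rewrite QE // d1 // d2 //.
under [RHS]eq_integral do rewrite EFinD !EFinM.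
rewrite ge0_integralD //.
all: try by move=> w _; rewrite lee_fin mulr_ge0.
all: try by apply: measurable_funeM; exact/measurable_EFinP.
rewrite !ge0_integralZl_EFin //.
all: try exact/measurable_EFinP.
all: by move=> w _; rewrite lee_fin.
Qed.

End Densities.

(** * The value for a fixed measure *)

Section BoundedBelow.
Context {R : realType} {d : measure_display} {T : measurableType d}.
Implicit Types (Q : probability T R) (f g : T -> R).

Lemma bounded_integrable Q f (c : R) A : measurable A -> measurable_fun setT f ->
  (forall w, `|f w| <= c) -> Q.-integrable A (EFin \o f).
Proof.
move=> mA mf fc; apply: (integrableS measurableT) => //.
apply: (@le_integrable _ _ _ _ _ measurableT _ (EFin \o cst c)).
- exact/measurable_EFinP.
- by move=> w _ /=; rewrite lee_fin (le_trans (fc w)) // ler_norm.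
- exact: finite_measure_integrable_cst.
Qed.

(** Reduces expectations of payoffs bounded below, possibly infinite, to integrals of nonnegative
    functions, where additivity and Fatou hold without integrability. *)
Lemma expectation_shift Q f (c : R) : measurable_fun setT f ->
  (forall w, c <= f w) -> ('E_Q[f] = \int[Q]_w (f w - c)%:E + c%:E)%E.
Proof.
move=> mf cf; rewrite unlock.
pose cp := Num.max c 0; pose cn := Num.max (- c) 0.
have cE : c = cp - cn.
  by rewrite /cp /cn; case: (leP c 0) => h; [rewrite max_l|rewrite max_r]; lra.
have cp0 : 0 <= cp by rewrite le_max lexx orbT.
have cn0 : 0 <= cn by rewrite le_max lexx orbT.
have mp : measurable_fun setT (fun w => (f^\+ w)%:E).
  by apply/measurable_EFinP; exact: measurable_funrpos.
have mn : measurable_fun setT (fun w => (f^\- w)%:E).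
  by apply/measurable_EFinP; exact: measurable_funrneg.
have mc : measurable_fun setT (fun w => (f w - c)%:E).
  by apply/measurable_EFinP; exact: measurable_funB.
have cst1 (a : R) : (\int[Q]_w (cst a%:E w) = a%:E)%E.
  by rewrite integral_cst // [X in (_ * X)%E]probability_setT mule1.
have key : (\int[Q]_w (f^\+ w)%:E + cn%:E =
    \int[Q]_w (f w - c)%:E + \int[Q]_w (f^\- w)%:E + cp%:E)%E.
  rewrite -[X in (_ + X = _)%E](cst1 cn) -[X in (_ = _ + X)%E](cst1 cp).
  rewrite -!ge0_integralD //.
  all: try by move=> w _; rewrite ?adde_ge0 // lee_fin ?subr_ge0 ?funrpos_ge0 ?funrneg_ge0.
  - apply: eq_integral => w _ /=; rewrite -!EFinD; congr EFin.
    have : f^\+ w - f^\- w = f w := congr1 (@^~ w) (funrposBneg f).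
    by move: (f w) (f^\+ w) (f^\- w) => *; lra.
  - exact: emeasurable_funD.
have nfin : (\int[Q]_w (f^\- w)%:E)%E \is a fin_num.
  rewrite ge0_fin_numE; last by apply: integral_ge0 => w _; rewrite lee_fin funrneg_ge0.
  apply: (@le_lt_trans _ _ (\int[Q]_w (cst `|c|%:E w))%E); last by rewrite cst1 ltry.
  apply: ge0_le_integral => //; first by move=> w _; rewrite lee_fin funrneg_ge0.
  move=> w _; rewrite lee_fin /funrneg ge_max normr_ge0 andbT.
  by have := ler_norm (- c); rewrite normrN; have := cf w; lra.
have p0 : (0 <= \int[Q]_w (f^\+ w)%:E)%E.
  by apply: integral_ge0 => w _; rewrite lee_fin funrpos_ge0.
rewrite integralE -/(EFin \o f) funerpos funerneg.
move: key nfin p0.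
case: (\int[Q]_w (f^\+ w)%:E)%E => [p| |] //; case: (\int[Q]_w (f^\- w)%:E)%E => [n| |] //;
  case: (\int[Q]_w (f w - c)%:E)%E => [r| |] //=.
by rewrite -!EFinD => -[key _ _]; congr EFin; lra.
Qed.

End BoundedBelow.

(** * Approximate mixtures by pasting *)

Section FixedMeasure.
Context {R : realType} {d : measure_display} {T : measurableType d}.
Implicit Types (Q : probability T R) (f g X : T -> R).

Definition paste (A : set T) f g w := if w \in A then f w else g w.

Lemma measurable_paste A f g : measurable A -> measurable_fun setT f ->
  measurable_fun setT g -> measurable_fun setT (paste A f g).
Proof.
move=> mA mf mg; apply: measurable_fun_ifT => //.
apply: (measurable_fun_bool true); rewrite setTI (_ : _ @^-1` _ = A) //.
by apply/seteqP; split => w /=; [move/set_mem|move/mem_set].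
Qed.

(** Pasting [f] over [g] on [A] changes the integral by that of [f - g] over [A]. The approximate
    Lyapunov theorem is applied to these two set functions, dominated by the measure
    [2 c (Q1 + Q2)]. *)
Lemma approximate_mixture (C : nat -> set T) Q1 Q2 f1 g1 f2 g2 (c t e : R) :
  (forall n, measurable (C n)) -> separating C ->
  (forall x, Q1 [set x] = 0%E) -> (forall x, Q2 [set x] = 0%E) ->
  measurable_fun setT f1 -> measurable_fun setT g1 ->
  measurable_fun setT f2 -> measurable_fun setT g2 ->
  (forall w, [/\ `|f1 w| <= c, `|g1 w| <= c, `|f2 w| <= c & `|g2 w| <= c]) ->
  0 <= t <= 1 -> 0 < e ->
  exists2 A, measurable A &
    `|\int[Q1]_w paste A f1 g1 w - (t * \int[Q1]_w f1 w + (1 - t) * \int[Q1]_w g1 w)| <= e /\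
    `|\int[Q2]_w paste A f2 g2 w - (t * \int[Q2]_w f2 w + (1 - t) * \int[Q2]_w g2 w)| <= e.
Proof.
move=> mC sepC Q10 Q20 mf1 mg1 mf2 mg2 bd t01 e0.
pose v Q f g S := \int[Q]_(w in S) (f w - g w).
have bint Q f A : measurable A -> measurable_fun setT f ->
    (forall w, `|f w| <= c + c) -> Q.-integrable A (EFin \o f).
  by move=> mA mf; exact: bounded_integrable.
have bnd f g w : `|f w| <= c -> `|g w| <= c -> `|f w - g w| <= c + c.
  by move=> fc gc; rewrite (le_trans (ler_normB _ _)) // lerD.
have bnd1 f w : `|f w| <= c -> `|f w| <= c + c.
  by move=> fc; have := normr_ge0 (f w); lra.
have v_add Q f g : measurable_fun setT f -> measurable_fun setT g ->
    (forall w, `|f w| <= c) -> (forall w, `|g w| <= c) ->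
    additive_on_measurable (v Q f g).
  move=> mf mg fc gc A B mA mB AB; apply: Rintegral_setU => //.
    apply: bint; [exact: measurableU|exact: measurable_funB|].
    by move=> w; exact: bnd.
  by apply/disj_setPS; rewrite AB.
have cc0 : 0 <= c + c.
  by have [? _ _ _] := bd point; have := normr_ge0 (f1 point); lra.
have v_le Q f g A : measurable_fun setT f -> measurable_fun setT g ->
    (forall w, `|f w| <= c) -> (forall w, `|g w| <= c) -> measurable A ->
    `|v Q f g A| <= (c + c) * fine (Q A).
  move=> mf mg fc gc mA.
  have ifg : Q.-integrable A (EFin \o (fun w => f w - g w)).
    by apply: bint => //; [exact: measurable_funB|move=> w; exact: bnd].
  apply: le_trans (le_normr_Rintegral mA ifg) _.
  rewrite -(Rintegral_cst Q mA); apply: le_Rintegral => //.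
  - exact: integrable_norm.
  - exact: finite_measure_integrable_cst.
  - by move=> w _; exact: bnd.
have v_paste Q f g A : measurable_fun setT f -> measurable_fun setT g ->
    (forall w, `|f w| <= c) -> (forall w, `|g w| <= c) -> measurable A ->
    \int[Q]_w paste A f g w = \int[Q]_w g w + v Q f g A.
  move=> mf mg fc gc mA.
  rewrite /v [X in _ + X]Rintegral_mkcond.
  rewrite (@eq_Rintegral _ _ _ Q setT
    (fun w => g w + ((fun w => f w - g w) \_ A) w)); last first.
    by move=> w _; rewrite /paste /patch /=; case: ifP => _; [ring|rewrite addr0].
  rewrite RintegralD //; first by apply: bint => // w; exact: bnd1.
  rewrite -restrict_EFin; apply/(integrable_mkcond _ mA).
  by apply: bint => //; [exact: measurable_funB|move=> w; exact: bnd].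
have v_setT Q f g : measurable_fun setT f -> measurable_fun setT g ->
    (forall w, `|f w| <= c) -> (forall w, `|g w| <= c) ->
    v Q f g setT = \int[Q]_w f w - \int[Q]_w g w.
  move=> mf mg fc gc; rewrite /v RintegralB //; by apply: bint => // w; exact: bnd1.
have f1c w : `|f1 w| <= c by have [] := bd w.
have g1c w : `|g1 w| <= c by have [] := bd w.
have f2c w : `|f2 w| <= c by have [] := bd w.
have g2c w : `|g2 w| <= c by have [] := bd w.
pose mQ (n : nat) : {measure set T -> \bar R} :=
  mscale (NngNum cc0) (if n is 0%N then Q1 else Q2).
have ME A : msum mQ 2 A = ((c + c)%:E * Q1 A + (c + c)%:E * Q2 A)%E.
  by rewrite /msum /= big_ord_recl big_ord1.
have Mfin : fin_num_fun (msum mQ 2).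
  by move=> A mA; rewrite ME fin_numD !fin_numM // fin_num_measure.
pose M : {finite_measure set T -> \bar R} :=
  HB.pack (msum mQ 2) (Measure_isFinite.Build _ _ _ (msum mQ 2) Mfin).
have [||||A [mA A1 A2]] := @approximate_lyapunov _ _ _ C M
  (v Q1 f1 g1) (v Q2 f2 g2) t e mC sepC _ _ _ _ t01 e0.
- by move=> x; rewrite /= ME Q10 Q20 !mule0 adde0.
- exact: v_add.
- exact: v_add.
- move=> A mA; rewrite /= ME fineD ?fin_numM ?fin_num_measure //.
  by rewrite !fineM ?fin_num_measure // lerD // v_le.
exists A => //; rewrite !v_paste //; move: A1 A2; rewrite !v_setT // => A1 A2.
split; [move: A1|move: A2]; congr (`|_| <= _); ring.
Qed.

End FixedMeasure.

(** * A multiplier for the budget constraint *)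

Section Lagrange.
Context {R : realType} {d : measure_display} {T : measurableType d}.
Context (U : R -> R) (U_nd : nondecreasing_on_nneg U).
Context (W : T -> R) (mW : measurable_fun setT W) (W0 : forall w, 0 < W w).
Implicit Types (Q Qe : probability T R) (X Y : T -> R).

(** Boundedness makes cost and utility real under every measure, so that their pairs lie in the
    plane. *)
Definition bounded_claims : set (T -> R) :=
  [set X : T -> R | [/\ measurable_fun setT X, forall w, 0 <= X w <= W w
             & exists n : R, forall w, X w <= n]].

Lemma bounded_claims_norm X1 X2 : bounded_claims X1 -> bounded_claims X2 ->
  exists c : R, forall w, [/\ `|X1 w| <= c, `|X2 w| <= c,
    `|utilW U W X1 w| <= c & `|utilW U W X2 w| <= c].
Proof.
move=> [_ b1 [n1 X1n]] [_ b2 [n2 X2n]].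
pose n := Num.max n1 n2; pose c := Num.max `|n| (Num.max `|U 0| `|U n|).
have h X w : 0 <= X w <= W w -> X w <= n -> `|X w| <= c /\ `|utilW U W X w| <= c.
  move=> /andP[x0 xW] xn; split.
    by rewrite ger0_norm // /c le_max (le_trans xn (ler_norm n)).
  have u0 := truncation_ge U_nd (W0 w) x0.
  have u1 : truncation U (W w) (X w) <= U n.
    by apply: le_trans (truncation_le_id U_nd (W0 w) x0) _; exact: U_nd.
  have [ca cb] : `|U 0| <= c /\ `|U n| <= c by rewrite /c !le_max !lexx !orbT.
  rewrite /utilW ler_norml; apply/andP; split.
    by move: ca; rewrite ler_norml => /andP[? _]; lra.
  by move: cb; rewrite ler_norml => /andP[_ ?]; lra.
exists c => w.
have [] := h X1 w (b1 w); first by rewrite (le_trans (X1n w)) // le_max lexx.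
by have [] := h X2 w (b2 w); first by rewrite (le_trans (X2n w)) // le_max lexx orbT.
Qed.

Lemma bounded_claims_paste A X1 X2 : measurable A -> bounded_claims X1 ->
  bounded_claims X2 -> bounded_claims (paste A X1 X2).
Proof.
move=> mA [m1 b1 [n1 X1n]] [m2 b2 [n2 X2n]]; split.
- exact: measurable_paste.
- by move=> w; rewrite /paste; case: ifP.
- exists (Num.max n1 n2) => w; rewrite /paste le_max.
  by case: ifP; rewrite ?X1n ?X2n ?orbT.
Qed.

Lemma measurable_utilW X : measurable_fun setT X -> (forall w, 0 <= X w) ->
  measurable_fun setT (utilW U W X).
Proof. by move=> mX X0; exact: measurable_truncation. Qed.

Lemma bounded_claims_ge0 X w : bounded_claims X -> 0 <= X w.
Proof. by move=> [_ /(_ w)/andP[]]. Qed.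

Lemma measurable_utilW_bounded X : bounded_claims X ->
  measurable_fun setT (utilW U W X).
Proof.
by move=> bX; apply: measurable_utilW => [|w]; [case: bX|exact: bounded_claims_ge0].
Qed.

(** Each claim either exceeds the budget or has utility at most [m], so the pairs (excess cost,
    shortfall from [m + e]) avoid the closed negative quadrant. [approximate_mixture] makes them
    approximately convex, and the separating weight gives [mu = l / (1 - l)]. *)
Lemma lagrange_multiplier (C : nat -> set T) Q Qe (x m e : R) :
  (forall n, measurable (C n)) -> separating C ->
  (forall w, Q [set w] = 0%E) -> (forall w, Qe [set w] = 0%E) -> 0 < x ->
  (forall X, bounded_claims X -> \int[Qe]_w X w <= x ->
     \int[Q]_w utilW U W X w <= m) -> 0 < e ->
  exists2 mu, 0 <= mu & forall X, bounded_claims X ->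
    \int[Q]_w utilW U W X w <= m + e + mu * (\int[Qe]_w X w - x).
Proof.
move=> mC sepC Q0 Qe0 x0 um e0.
pose cost X := \int[Qe]_w X w; pose util X := \int[Q]_w utilW U W X w.
have [||l l01 hl] := @separate_quadrant _
  [set (cost X - x, m + e - util X) | X in bounded_claims].
- move=> _ _ t eps [X1 b1 <-] [X2 b2 <-] t01 eps0.
  have [c Xc] := bounded_claims_norm b1 b2.
  have [|||||A mA [h1 h2]] := @approximate_mixture _ _ _ C Qe Q X1 X2
    (utilW U W X1) (utilW U W X2) c t eps mC sepC Qe0 Q0 _ _ _ _ _ t01 eps0.
  - by case: b1.
  - by case: b2.
  - exact: measurable_utilW_bounded.
  - exact: measurable_utilW_bounded.
  - by [].
  exists (cost (paste A X1 X2) - x, m + e - util (paste A X1 X2)).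
  have uE : util (paste A X1 X2) = \int[Q]_w paste A (utilW U W X1) (utilW U W X2) w.
    by apply: eq_Rintegral => w _; rewrite /utilW /paste; case: ifP.
  split; first by exists (paste A X1 X2) => //; exact: bounded_claims_paste.
  - by move: h1; rewrite ler_norml -/(cost _) -/(cost X1) -/(cost X2) /= => /andP[_ ?]; lra.
  - by move: h2; rewrite -uE ler_norml -/(util X1) -/(util X2) /= => /andP[? _]; lra.
- move=> _ [X bX <-] /=; have [xc|cx] := ltP x (cost X); first by left; lra.
  by right; have := um _ bX cx; rewrite -/(util X); lra.
have b0 : bounded_claims (cst 0).
  split; [exact: measurable_cst|by move=> w; rewrite lexx ltW|by exists 0].
(* Slater's condition: the zero claim costs strictly less than [x], so the weight cannot rest on
   cost alone. *)
have l1 : l < 1.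
  rewrite lt_neqAle (andP l01).2 andbT; apply/eqP => l1.
  have := hl _ (ex_intro2 _ _ _ b0 erefl).
  by rewrite /= l1 /cost Rintegral_cst // mul0r; lra.
have l1' : 0 < 1 - l by lra.
exists (l / (1 - l)); first by rewrite divr_ge0 ?(andP l01).1 // ltW.
move=> X bX; have /= := hl _ (ex_intro2 _ _ _ bX erefl).
rewrite -/(util X) -/(cost X) => h.
have : 0 <= (l * (cost X - x) + (1 - l) * (m + e - util X)) / (1 - l).
  by rewrite divr_ge0 // ltW.
rewrite mulrDl [_ * (_ - util X)]mulrC mulfK ?gt_eqF // => {}h.
by rewrite [_ / _ * _]mulrAC; lra.
Qed.

End Lagrange.

(** * From the multiplier to the concavified value *)

Section FixedMeasureValue.
Context {R : realType} {d : measure_display} {T : measurableType d}.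
Context (U : R -> R) (U_nd : nondecreasing_on_nneg U).
Context (W : T -> R) (mW : measurable_fun setT W) (W0 : forall w, 0 < W w).
Implicit Types (Q Qe : probability T R) (X Y : T -> R).

Lemma nneg_dense_seq : exists q : nat -> R, (forall n, 0 <= q n) /\
  forall y e, 0 <= y -> 0 < e -> exists2 n, y < q n & q n < y + e.
Proof.
exists (fun n => Num.max 0 (ratr (odflt 0%Q (unpickle n)))); split.
  by move=> n; rewrite le_max lexx.
move=> y e y0 e0; have [q] := rat_in_itvoo (ltr_pwDr e0 (lexx y)).
rewrite in_itv /= => /andP[yq qe]; exists (pickle q); rewrite pickleK /= max_r //.
all: exact: le_trans (ltW yq).
Qed.

(** The witness is the pointwise supremum of the penalized utility over countably many levels, minus
    [U 0]. The claim that keeps the best of the first [n] levels is bounded, so its penalized value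
    is at most [K]; monotone convergence transfers this to the supremum. *)
Lemma penalized_selection Q Qe Y (mu K : R) : density_of Q Qe Y -> 0 <= mu ->
  (forall X, bounded_claims W X ->
     \int[Q]_w utilW U W X w - mu * \int[Qe]_w X w <= K) ->
  exists S : T -> \bar R, [/\ measurable_fun setT S, forall w, (0 <= S w)%E,
    (\int[Q]_w S w <= (K - U 0)%:E)%E &
    forall w y, 0 <= y -> ((truncation U (W w) y - U 0)%:E <= S w + (mu * Y w * y)%:E)%E].
Proof.
move=> dY mu0 hK; have [mY Y0 _] := dY.
have [q [q0 qdense]] := nneg_dense_seq.
pose val X w := utilW U W X w - mu * (Y w * X w).
pose c n w := Num.min (q n) (W w).
pose step n X w := if val X w < val (c n) w then c n w else X w.
pose S := fix S n : T -> R := if n is n'.+1 then step n' (S n') else cst 0.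
have bc n : bounded_claims W (c n).
  split; first exact: measurable_minr.
    by move=> w; rewrite le_min q0 (ltW (W0 w)) ge_min lexx orbT.
  by exists (q n) => w; rewrite ge_min lexx.
have mval X : bounded_claims W X -> measurable_fun setT (val X).
  move=> bX; apply: measurable_funB; first exact: measurable_utilW_bounded.
  apply: measurable_funM => //; apply: measurable_funM => //; by case: bX.
have bS n : bounded_claims W (S n).
  elim: n => [|n [mS S1 [k Sk]]].
    split; [exact: measurable_cst|by move=> w; rewrite lexx ltW|by exists 0].
  split.
  - apply: measurable_fun_ifT; [|by case: (bc n)|by []].
    by apply: measurable_fun_ltr; apply: mval => //; split => //; exists k.
  - by move=> w; rewrite /= /step; case: ifP => _ //; case: (bc n).
  - exists (Num.max k (q n)) => w; rewrite /= /step le_max.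
    by case: ifP => _; rewrite ?Sk ?ge_min ?lexx ?orbT.
have valS n w : val (S n) w <= val (S n.+1) w.
  rewrite [in X in _ <= X]/val /utilW /= /step.
  by case: ifPn => // /ltW.
have valc n w : val (c n) w <= val (S n.+1) w.
  rewrite [in X in _ <= X]/val /utilW /= /step.
  by case: ifPn => //; rewrite -leNgt.
have valnd w : {homo (fun n => val (S n) w) : n m / (n <= m)%N >-> n <= m}.
  by apply/nondecreasing_seqP => n; exact: valS.
have val0 n w : U 0 <= val (S n) w.
  apply: le_trans (valnd w _ _ (leq0n n)).
  by rewrite /val /utilW /truncation /= min_l ?mulr0 ?subr0 // ltW.
have valK n : (\int[Q]_w (val (S n) w - U 0)%:E <= (K - U 0)%:E)%E.
  have [k Sk] := bounded_claims_norm U_nd W0 (bS n) (bS n).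
  have mSn : measurable_fun setT (S n) by case: (bS n).
  have iu : Q.-integrable setT (EFin \o utilW U W (S n)).
    apply: (@bounded_integrable _ _ _ _ _ k) => //; first exact: measurable_utilW_bounded.
    by move=> w; have [] := Sk w.
  have iX : Qe.-integrable setT (EFin \o S n).
    by apply: (@bounded_integrable _ _ _ _ _ k) => // w; have [] := Sk w.
  have YX := integral_density dY iX.
  have Xfin : (\int[Qe]_w (S n w)%:E)%E \is a fin_num by exact: integrable_fin_num.
  have iYX : Q.-integrable setT (fun w => (S n w)%:E * (Y w)%:E)%E.
    apply/integrableP; split.
      by apply: emeasurable_funM; exact/measurable_EFinP.
    under eq_integral do rewrite -EFinM gee0_abs ?lee_fin ?mulr_ge0
      ?(bounded_claims_ge0 _ (bS n)) // EFinM.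
    by rewrite -YX ltey_eq Xfin.
  have := hK _ (bS n); rewrite /Rintegral.
  have ufin : (\int[Q]_w (utilW U W (S n) w)%:E)%E \is a fin_num by exact: integrable_fin_num.
  rewrite -lee_fin EFinB EFinM !fineK // YX.
  rewrite -integralZl // -integralB //; last exact: integrableZl.
  move=> h.
  have -> : (\int[Q]_w (val (S n) w - U 0)%:E = \int[Q]_w (val (S n) w)%:E - (U 0)%:E)%E.
    have := @expectation_shift _ _ _ Q (val (S n)) (U 0) (mval _ (bS n)) (val0 n).
    by rewrite unlock => ->; rewrite addeK.
  rewrite EFinB; apply: leeB => //; apply: le_trans h.
  rewrite le_eqVlt; apply/orP; left; apply/eqP/eq_integral => w _.
  by rewrite /val EFinB !EFinM [(_ * (S n w)%:E)%E]muleC.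
have mV n : measurable_fun setT (fun w => (val (S n) w - U 0)%:E).
  by apply/measurable_EFinP/measurable_funB => //; exact: mval.
have V0 n w : (0 <= (val (S n) w - U 0)%:E)%E by rewrite lee_fin subr_ge0.
have Vnd w : {homo (fun n => (val (S n) w - U 0)%:E) : n m / (n <= m)%N >-> (n <= m)%E}.
  by move=> n m nm; rewrite lee_fin lerB // valnd.
have Vcvg w : cvgn (fun n => (val (S n) w - U 0)%:E).
  by apply: ereal_nondecreasing_is_cvgn; exact: Vnd.
have Vle n w : ((val (S n) w - U 0)%:E <= limn (fun n => (val (S n) w - U 0)%:E))%E.
  rewrite (cvg_lim _ (ereal_nondecreasing_cvgn (Vnd w))) //.
  by apply: ereal_sup_ubound; exists n.
exists (fun w => limn (fun n => (val (S n) w - U 0)%:E)); split.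
- by apply: (emeasurable_fun_cvg (fun n w => (val (S n) w - U 0)%:E)) => // w _; exact: Vcvg.
- by move=> w; apply: le_trans (Vle 0%N w).
- rewrite monotone_convergence //.
  apply: lime_le; last by apply: nearW => n; exact: valK.
  apply: ereal_nondecreasing_is_cvgn => n m nm; apply: ge0_le_integral => //.
  by move=> w _; exact: Vnd.
- move=> w y y0; apply/lee_addgt0Pr => e e0.
  have z0 : 0 <= mu * Y w by rewrite mulr_ge0.
  have e1 : 0 < e / (mu * Y w + 1) by rewrite divr_gt0 // ltr_wpDl.
  (* Approaching [y] from above loses no utility, since [U] is nondecreasing, and this spacing
     raises the penalty by at most [e]. *)
  have [n yq qe] := qdense y _ y0 e1.
  apply: (@le_trans _ _ ((val (S n.+1) w - U 0)%:E + (mu * Y w * y)%:E + e%:E)%E); last first.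
    by rewrite leeD2r // leeD2r.
  rewrite -!EFinD lee_fin.
  have h1 := valc n w; rewrite /val /utilW {1}/truncation in h1.
  have cE : Num.min (c n w) (W w) = c n w by rewrite /c -minA minxx.
  have h2 : truncation U (W w) y <= U (c n w).
    apply: U_nd; first by rewrite le_min y0 ltW.
    by rewrite le_min !ge_min (ltW yq) lexx orbT.
  rewrite cE in h1.
  have h3 : mu * (Y w * c n w) <= mu * Y w * (y + e / (mu * Y w + 1)).
    rewrite mulrA ler_wpM2l // (le_trans _ (ltW qe)) //.
    by rewrite ge_min lexx.
  have h4 : mu * Y w * (e / (mu * Y w + 1)) <= e.
    by rewrite mulrA ler_pdivrMr ?ltr_wpDl // mulrC ler_wpM2l ?lerDl // ltW.
  by move: h1 h3; rewrite [in X in _ -> X -> _]mulrDr /val /utilW; lra.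
Qed.


Lemma measurable_utilWc X : measurable_fun setT X -> (forall w, 0 <= X w) ->
  measurable_fun setT (utilWc U W X).
Proof. by move=> mX X0; exact: measurable_concavification. Qed.

Lemma claims_belowP Qe x X : claims_below Qe W x X ->
  [/\ measurable_fun setT X, Qe.-integrable setT (EFin \o X), forall w, 0 <= X w
    & (\int[Qe]_w (X w)%:E <= x%:E)%E].
Proof.
move=> [/Lfun1_integrable iX X0 EX]; split => //.
- by apply/measurable_EFinP; exact: measurable_int iX.
- by move=> w; case/andP: (X0 w).
- by move: EX; rewrite unlock.
Qed.

Lemma claims_below_bounded Qe x X : bounded_claims W X ->
  (\int[Qe]_w (X w)%:E <= x%:E)%E -> claims_below Qe W x X.
Proof.
move=> [mX bX [n Xn]] EX; split => //; last by rewrite unlock.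
apply/Lfun1_integrable/(@bounded_integrable _ _ _ _ _ n) => // w.
by rewrite ger0_norm ?Xn //; case/andP: (bX w).
Qed.

(** At each [w], the map [y |-> U 0 + S w + mu Y(w) y] is an affine majorant of the truncated
    utility where [S w] is finite, hence it also dominates the concavification. Its integral along
    an affordable [X] is at most [m + e], as the penalty integrates to [mu E_Qe[X]]. *)
Lemma concavified_value_le (C : nat -> set T) Q Qe Y (x m : R) :
  (forall n, measurable (C n)) -> separating C ->
  (forall w, Q [set w] = 0%E) -> (forall w, Qe [set w] = 0%E) -> 0 < x ->
  density_of Q Qe Y ->
  (forall X, claims_below Qe W x X -> 'E_Q[utilW U W X] <= m%:E)%E ->
  (forall X, claims_below Qe W x X -> 'E_Q[utilWc U W X] <= m%:E)%E.
Proof.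
move=> mC sepC Q0 Qe0 x0 dY um X cX; have [mY Y0 _] := dY.
apply/lee_addgt0Pr => e e0.
have [X' bX' EX'|mu mu0 hmu] :=
    @lagrange_multiplier _ _ _ _ U_nd W mW W0 C Q Qe x m e mC sepC Q0 Qe0 x0 _ e0.
  have [k Xk] := bounded_claims_norm U_nd W0 bX' bX'.
  have iX : Qe.-integrable setT (EFin \o X').
    by apply: (@bounded_integrable _ _ _ _ _ k) => //; [case: bX'|move=> w; case: (Xk w)].
  have iu : Q.-integrable setT (EFin \o utilW U W X').
    apply: (@bounded_integrable _ _ _ _ _ k) => //; first exact: measurable_utilW_bounded.
    by move=> w; case: (Xk w).
  rewrite -lee_fin /Rintegral fineK ?integrable_fin_num //.
  have := um X'; rewrite unlock; apply; apply: claims_below_bounded => //.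
  by rewrite -[leLHS]fineK ?lee_fin //; exact: integrable_fin_num.
have [|S [mS S0 SK hS]] := @penalized_selection Q Qe Y mu (m + e - mu * x) dY mu0.
  by move=> X' bX'; have := hmu _ bX'; lra.
have [mX iX X0 EX] := claims_belowP cX.
have YX := integral_density dY iX.
have mu_Y : measurable_fun setT (fun w => (mu * Y w * X w)%:E).
  by apply/measurable_EFinP/measurable_funM => //; exact: measurable_funM.
rewrite (@expectation_shift _ _ _ _ _ (U 0)); last first.
- by move=> w; exact: concavification_geU0.
- exact: measurable_utilWc.
have h : (\int[Q]_w (utilWc U W X w - U 0)%:E <=
    \int[Q]_w (S w + (mu * Y w * X w)%:E))%E.
  apply: ge0_le_integral => //.
  - by move=> w _; rewrite lee_fin subr_ge0; exact: concavification_geU0.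
  - by apply/measurable_EFinP/measurable_funB => //; exact: measurable_utilWc.
  - exact: emeasurable_funD.
  move=> w _; have := hS w; have := S0 w.
  case: (S w) => [s| |] // _ hs; last by rewrite addye // leey.
  rewrite -EFinD lee_fin lerBlDr addrAC.
  apply: concavification_le_affine => // z z0.
  by have := hs _ z0; rewrite -EFinD lee_fin; lra.
apply: (@le_trans _ _ ((m + e - mu * x - U 0)%:E + mu%:E * x%:E + (U 0)%:E)%E); last first.
  by rewrite -EFinM -!EFinD lee_fin; lra.
rewrite leeD2r //; apply: le_trans h _.
rewrite ge0_integralD //; last first.
  by move=> w _; rewrite lee_fin !mulr_ge0.
apply: leeD => //.
have -> : (\int[Q]_w (mu * Y w * X w)%:E = mu%:E * \int[Qe]_w (X w)%:E)%E.
  rewrite YX -ge0_integralZl_EFin //.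
  - by apply: eq_integral => w _; rewrite -!EFinM mulrAC mulrA.
  - by move=> w _; rewrite -EFinM lee_fin mulr_ge0.
  - by apply: emeasurable_funM; exact/measurable_EFinP.
by rewrite lee_wpmul2l.
Qed.

End FixedMeasureValue.

(** * Robust values *)

Section Mixtures.
Local Open Scope ereal_scope.
Context {R : realType} {d : measure_display} {T : measurableType d}.
Implicit Types (P Q : probability T R) (QQ : set (probability T R)) (f g : T -> R).

Definition mixture (t : R) Q1 Q2 Q := forall A, measurable A ->
  Q A = t%:E * Q1 A + (1 - t)%:E * Q2 A.

Lemma integral_mixture (t : R) Q1 Q2 Q (h : T -> \bar R) :
  (0 <= t <= 1)%R -> mixture t Q1 Q2 Q -> measurable_fun setT h ->
  (forall w, 0 <= h w) ->
  \int[Q]_w h w = t%:E * \int[Q1]_w h w + (1 - t)%:E * \int[Q2]_w h w.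
Proof.
move=> /andP[t0 t1] QE mh h0; have t1' : (0 <= 1 - t)%R by rewrite subr_ge0.
rewrite (eq_measure_integral (measure_add (mscale (NngNum t0) Q1) (mscale (NngNum t1') Q2))).
  by rewrite ge0_integral_measure_add // !ge0_integral_mscale.
by move=> A mA _; rewrite [RHS]measure_addE; exact: QE.
Qed.

Lemma expectation_mixture_le (t : R) Q1 Q2 Q f (c a b : R) :
  (0 <= t <= 1)%R -> mixture t Q1 Q2 Q -> measurable_fun setT f ->
  (forall w, c <= f w)%R -> 'E_Q1[f] <= a%:E -> 'E_Q2[f] <= b%:E ->
  'E_Q[f] <= (t * a + (1 - t) * b)%:E.
Proof.
move=> t01 QE mf cf; rewrite !(expectation_shift _ mf cf).
rewrite (integral_mixture t01 QE); last 2 first.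
- by apply/measurable_EFinP/measurable_funB.
- by move=> w; rewrite lee_fin subr_ge0.
case/andP: t01 => t0 t1.
have shift (I : \bar R) (r : R) : (I + c%:E <= r%:E) = (I <= (r - c)%:E).
  by rewrite EFinB leeBrDr.
rewrite !shift => h1 h2.
apply: (@le_trans _ _ (t%:E * (a - c)%:E + (1 - t)%:E * (b - c)%:E)).
  by apply: leeD; apply: lee_wpmul2l => //; rewrite lee_fin ?subr_ge0.
by rewrite -!EFinM -EFinD lee_fin; lra.
Qed.

Lemma expectation_le Q f g (c : R) : measurable_fun setT f -> measurable_fun setT g ->
  (forall w, c <= f w)%R -> (forall w, f w <= g w)%R -> 'E_Q[f] <= 'E_Q[g].
Proof.
move=> mf mg cf fg; have cg w : (c <= g w)%R by exact: le_trans (fg w).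
rewrite (expectation_shift _ mf cf) (expectation_shift _ mg cg) leeD2r //.
apply: ge0_le_integral => //.
- by move=> w _; rewrite lee_fin subr_ge0.
- exact/measurable_EFinP/measurable_funB.
- exact/measurable_EFinP/measurable_funB.
- by move=> w _; rewrite lee_fin lerB.
Qed.

Lemma expectation_ge Q f (c : R) : measurable_fun setT f ->
  (forall w, c <= f w)%R -> c%:E <= 'E_Q[f].
Proof.
move=> mf cf; rewrite (expectation_shift _ mf cf) leeDr //.
by apply: integral_ge0 => w _; rewrite lee_fin subr_ge0.
Qed.

(* Mixing a little of an equivalent measure of finite value into any member of *)
(* QQ gives an equivalent measure with nearly the same value.                  *)
Lemma inf_sup_equivalent_part P QQ Q0 (FF : set (T -> R)) (c s0 : R) :
  convex_probabilities QQ -> (forall Q, QQ Q -> Q `<< P) ->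
  equivalent_part P QQ Q0 -> FF !=set0 ->
  (forall f, FF f -> measurable_fun setT f /\ forall w, (c <= f w)%R) ->
  (forall f, FF f -> 'E_Q0[f] <= s0%:E) ->
  ereal_inf [set ereal_sup [set 'E_Q[f] | f in FF] | Q in equivalent_part P QQ] =
  ereal_inf [set ereal_sup [set 'E_Q[f] | f in FF] | Q in QQ].
Proof.
move=> cQ QP [QQ0 [_ PQ0]] [f0 Ff0] mF F0.
apply/eqP; rewrite eq_le; apply/andP; split; last first.
  by apply: ereal_inf_le_tmp => _ [Q [QQQ _] <-]; exists Q.
apply: le_ereal_inf_tmp => _ [Q QQQ <-].
have cs : c%:E <= ereal_sup [set 'E_Q[f] | f in FF].
  have [mf cf] := mF _ Ff0.
  by apply: le_trans (expectation_ge _ mf cf) _; apply: ereal_sup_ubound; exists f0.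
move: cs; case sE : (ereal_sup _) => [s| |] // cs; last by rewrite leey.
apply/lee_addgt0Pr => e e0.
(* The mixed value is at most [s + t (s0 - s)]; this [t] keeps the increase below [e]. *)
pose t := Num.min 1%R (e / (`|s0 - s| + 1))%R.
have N1 : (0 < `|s0 - s| + 1)%R by rewrite ltr_wpDl.
have t0 : (0 < t)%R by rewrite lt_min ltr01 divr_gt0.
have t1 : (t <= 1)%R by rewrite ge_min lexx.
have t01 : (0 <= t <= 1)%R by rewrite ltW.
have te : (t * (s0 - s) <= e)%R.
  apply: (@le_trans _ _ (t * (`|s0 - s| + 1))%R).
    by apply: ler_wpM2l; [exact: ltW|have := ler_norm (s0 - s)%R; lra].
  by rewrite -ler_pdivlMr // /t ge_min lexx orbT.
have [Qt QQt QtE] := cQ _ _ t QQ0 QQQ t01.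
have PQt : P `<< Qt.
  apply/dominatesP => A mA; rewrite QtE // => QA.
  apply: ((dominatesP _ _).1 PQ0) => //.
  have : t%:E * Q0 A + (1 - t)%:E * Q A == 0 by rewrite QA.
  rewrite padde_eq0 ?mule_ge0 ?lee_fin ?subr_ge0 //; last exact: ltW.
  by rewrite mule_eq0 eqe gt_eqF //= => /andP[/eqP].
apply: (@le_trans _ _ (ereal_sup [set 'E_Qt[f] | f in FF])).
  by apply: ereal_inf_lbound; exists Qt => //; split => //; split => //; exact: QP.
apply: ge_ereal_sup => _ [f Ff <-]; have [mf cf] := mF _ Ff.
apply: (@le_trans _ _ (t * s0 + (1 - t) * s)%:E); last by rewrite lee_fin; lra.
apply: (expectation_mixture_le t01 QtE mf cf); first exact: F0.
by rewrite -sE; apply: ereal_sup_ubound; exists f.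
Qed.

End Mixtures.

(** * Minimax equality for the concavified utility *)

Section RobustMinimax.
Context {R : realType} {d : measure_display} {T : measurableType d}.
Context (U : R -> R) (U_nd : nondecreasing_on_nneg U) (U_sub : sublinear U).
Context (W : T -> R) (mW : measurable_fun setT W) (W0 : forall w, 0 < W w).
Context (P Qe : probability T R) (QQ : set (probability T R)) (x : R) (x0 : 0 < x).
Implicit Types (Q : probability T R) (X : T -> R).

Let XW := claims_below Qe W x.
Let Xb := [set X : T -> R | bounded_claims W X /\ XW X].

Lemma claims_below0 : XW (cst 0).
Proof.
apply: claims_below_bounded => //.
  split; [exact: measurable_cst|by move=> w; rewrite lexx ltW|by exists 0].
by rewrite integral0 lee_fin ltW.
Qed.

Lemma measurable_utilWc_claims X : XW X -> measurable_fun setT (utilWc U W X).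
Proof. by move=> /claims_belowP[mX _ X0 _]; exact: measurable_utilWc. Qed.

Lemma measurable_utilW_claims X : XW X -> measurable_fun setT (utilW U W X).
Proof. by move=> /claims_belowP[mX _ X0 _]; exact: measurable_utilW. Qed.

Lemma utilWc_geU0 X w : XW X -> U 0 <= utilWc U W X w.
Proof. by move=> /claims_belowP[_ _ X0 _]; exact: concavification_geU0. Qed.

Lemma utilW_geU0 X w : XW X -> U 0 <= utilW U W X w.
Proof. by move=> /claims_belowP[_ _ X0 _]; exact: truncation_ge. Qed.

(** The concavification of [U] itself, finite by sublinearity, bounds all truncated ones
    independently of the cap. *)
Lemma utilWc_bounded X : Xb X -> exists c, forall w, `|utilWc U W X w| <= c.
Proof.
move=> [[mX b [n Xn]] _]; pose n' := Num.max 0 n; have n0 : 0 <= n' by rewrite le_max lexx.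
exists (Num.max `|U 0| `|concavification U n'|) => w.
have /andP[Xw _] := b w.
have lo := concavification_geU0 U_nd (W0 w) Xw.
have hi : utilWc U W X w <= concavification U n'.
  apply: le_trans (concavification_le_sublinear U_nd U_sub (W0 w) n0).
  by apply: concavification_nd => //; rewrite le_max Xn orbT.
rewrite /utilWc in hi *; rewrite le_max !ler_norml.
have := ler_norm (- U 0); rewrite normrN; have := ler_norm (concavification U n').
set C := concavification _ _ in lo hi * => h1 h2.
have [h|h] := leP `|U 0| `|concavification U n'|; apply/orP; [right|left]; apply/andP; split; lra.
Qed.

Lemma utilWc_integrable Q X : Xb X -> Q.-integrable setT (EFin \o utilWc U W X).
Proof.
move=> bX; have [c Xc] := utilWc_bounded bX.
by apply: (@bounded_integrable _ _ _ _ _ c) => //; apply: measurable_utilWc_claims; case: bX.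
Qed.

Lemma utilWc_concave t X1 X2 w : 0 <= t <= 1 -> XW X1 -> XW X2 ->
  t * utilWc U W X1 w + (1 - t) * utilWc U W X2 w <=
  utilWc U W (fun w => t * X1 w + (1 - t) * X2 w) w.
Proof.
move=> t01 /claims_belowP[_ _ p1 _] /claims_belowP[_ _ p2 _].
exact: concavification_concave.
Qed.

Lemma bounded_claims_convex t X1 X2 : 0 <= t <= 1 -> Xb X1 -> Xb X2 ->
  Xb (fun w => t * X1 w + (1 - t) * X2 w).
Proof.
move=> /andP[t0 t1] [[m1 b1 [n1 X1n]] X1W] [[m2 b2 [n2 X2n]] X2W].
have t1' : 0 <= 1 - t by rewrite subr_ge0.
have bX : bounded_claims W (fun w => t * X1 w + (1 - t) * X2 w).
  split.
  - by apply: measurable_funD; apply: measurable_funM.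
  - by move=> w; have /andP[? ?] := b1 w; have /andP[? ?] := b2 w; apply/andP; split; nra.
  - by exists (t * n1 + (1 - t) * n2) => w; rewrite lerD // ler_wpM2l.
split => //; apply: claims_below_bounded => //.
have [_ _ p1 E1] := claims_belowP X1W; have [_ _ p2 E2] := claims_belowP X2W.
under eq_integral do rewrite EFinD !EFinM.
rewrite ge0_integralD //.
all: try by move=> w _; rewrite lee_fin mulr_ge0.
all: try by apply: measurable_funeM; exact/measurable_EFinP.
rewrite !ge0_integralZl_EFin //.
all: try exact/measurable_EFinP.
all: try by move=> w _; rewrite lee_fin.
apply: (@le_trans _ _ (t%:E * x%:E + (1 - t)%:E * x%:E)%E).
  by apply: leeD; apply: lee_wpmul2l.
by rewrite -!EFinM -EFinD lee_fin; lra.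
Qed.

(** The claims [X] capped at [n] are bounded, affordable, and eventually equal to [X] at every
    point; Fatou concludes. *)
Lemma bounded_claims_approx Q X (b : R) : XW X ->
  (forall X', Xb X' -> 'E_Q[utilWc U W X'] <= b%:E)%E -> ('E_Q[utilWc U W X] <= b%:E)%E.
Proof.
move=> XX hb; have [mX iX X0 EX] := claims_belowP XX.
pose Xn (n : nat) w := Num.min (X w) n%:R.
have bXn n : Xb (Xn n).
  have bX : bounded_claims W (Xn n).
    split; first exact: measurable_minr.
      move=> w; rewrite le_min X0 ler0n /= ge_min.
      by have [_ /(_ w)/andP[_ ->]] := XX.
    by exists n%:R => w; rewrite ge_min lexx orbT.
  split => //; apply: claims_below_bounded => //; apply: le_trans EX.
  apply: ge0_le_integral => //.
  - by move=> w _; rewrite lee_fin le_min X0 ler0n.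
  - by apply/measurable_EFinP; case: bX.
  - exact/measurable_EFinP.
  - by move=> w _; rewrite lee_fin ge_min lexx.
have shift (I : \bar R) : (I + (U 0)%:E <= b%:E)%E = (I <= (b - U 0)%:E)%E.
  by rewrite EFinB leeBrDr.
have ge0 Y w : XW Y -> U 0 <= utilWc U W Y w by exact: utilWc_geU0.
have bn n : ('E_Q[utilWc U W (Xn n)] <= b%:E)%E by exact: hb.
rewrite (@expectation_shift _ _ _ _ _ (U 0)) ?shift; last 2 first.
- exact: measurable_utilWc_claims.
- by move=> w; exact: ge0.
apply: (@fatou_le _ _ _ _ (fun n w => utilWc U W (Xn n) w - U 0)).
- move=> n; apply: measurable_funB => //; apply: measurable_utilWc_claims.
  by case: (bXn n).
- by apply: measurable_funB => //; exact: measurable_utilWc_claims.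
- by move=> n w; rewrite subr_ge0; apply: ge0; case: (bXn n).
- by move=> w; rewrite subr_ge0; exact: ge0.
- apply: aeW => w; apply: cvg_near_cst; near=> n.
  rewrite /utilWc /Xn min_l //; near: n.
  exact: nbhs_infty_ger.
- move=> n; rewrite -shift -expectation_shift //.
    by apply: measurable_utilWc_claims; case: (bXn n).
  by move=> w; apply: ge0; case: (bXn n).
Unshelve. all: by end_near. Qed.

Theorem robust_minimax : convex_probabilities QQ -> (forall Q, QQ Q -> Q `<< P) ->
  closed_in_L0 P (densities P QQ) -> QQ !=set0 ->
  sup_inf XW QQ (utilWc U W) = inf_sup XW QQ (utilWc U W).
Proof.
move=> cQ QP clQ [Qi QQi]; apply/eqP; rewrite eq_le; apply/andP; split.
  apply: ge_ereal_sup => _ [X XX <-]; apply: le_ereal_inf_tmp => _ [Q QQQ <-].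
  apply: (@le_trans _ _ ('E_Q[utilWc U W X])%E); first by apply: ereal_inf_lbound; exists Q.
  by apply: ereal_sup_ubound; exists X.
have key (a b : R) : a < b -> (b%:E < inf_sup XW QQ (utilWc U W))%E ->
    (a%:E <= sup_inf XW QQ (utilWc U W))%E.
  move=> ab bI; pose I := {X | Xb X}.
  pose f (i : I) Q := (\int[Q]_w utilWc U W (sval i) w)%R.
  have fE (i : I) Q : ('E_Q[utilWc U W (sval i)] = (f i Q)%:E)%E.
    rewrite unlock /f /Rintegral fineK //; apply: integrable_fin_num => //.
    exact: utilWc_integrable (svalP i).
  have Qb Q : QQ Q -> exists i : I, b < f i Q.
    move=> QQQ; apply: contrapT => /forallNP nb; move: bI; apply/negP; rewrite -leNgt.
    apply: (@le_trans _ _ (ereal_sup [set 'E_Q[utilWc U W X] | X in XW])%E).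
      by apply: ereal_inf_lbound; exists Q.
    apply: ge_ereal_sup => _ [X XX <-]; apply: bounded_claims_approx => // X' bX'.
    by rewrite (fE (exist _ X' bX')) lee_fin leNgt; apply/negP/nb.
  have shift (J : \bar R) : (J + (U 0)%:E <= b%:E)%E = (J <= (b - U 0)%:E)%E.
    by rewrite EFinB leeBrDr.
  (* Subtracting [U 0] makes the constraint functions nonnegative, as the compactness theorem
     requires. *)
  have bridge Q Z i : density_of P Q Z ->
      (\int[P]_w ((utilWc U W (sval i) w - U 0) * Z w)%:E <= (b - U 0)%:E)%E = (f i Q <= b).
    move=> dZ; have [_ XX] := svalP i.
    have iu : Q.-integrable setT (EFin \o (fun w => utilWc U W (sval i) w - U 0)).
      have [c Xc] := utilWc_bounded (svalP i).
      apply: (@bounded_integrable _ _ _ _ _ (c + `|U 0|)) => //.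
        by apply: measurable_funB => //; exact: measurable_utilWc_claims.
      by move=> w; rewrite (le_trans (ler_normB _ _)) // lerD2r.
    have := integral_density dZ iu; under [in RHS]eq_integral do rewrite -EFinM.
    move=> <-; rewrite -shift -expectation_shift ?fE ?lee_fin //.
      exact: measurable_utilWc_claims.
    by move=> w; exact: utilWc_geU0.
  (* Otherwise every finite set of constraints [f i Q <= b] is satisfiable, and compactness produces
     a member of [QQ] satisfying all of them, against [Qb]. *)
  have [F FP] : exists F : seq I, forall Q, QQ Q -> exists2 i, List.In i F & b < f i Q.
    apply: contrapT => /forallNP noF.
    have [||||||Z [Q QQQ dZ] hZ] := @convex_constraints_compact _ _ _ P
      [set Z | exists2 Q, QQ Q & density_of P Q Z] I
      (fun i w => utilWc U W (sval i) w - U 0) (b - U 0).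
    - move=> Z [Q _ [mZ Z0 QZ]]; split => //.
      by rewrite -QZ //; exact: probability_le1.
    - move=> Z Z' dZ dZ'; have half : 0 <= (2^-1 : R) <= 1 by lra.
      have := densities_convex cQ half dZ dZ'.
      rewrite (_ : (fun w => _) = (fun w => (Z w + Z' w) / 2)) //.
      by apply/funext => w; lra.
    - by move=> Z_ Z; exact: densities_closed.
    - move=> i; apply: measurable_funB => //; apply: measurable_utilWc_claims.
      by case: (svalP i).
    - by move=> i w; rewrite subr_ge0; apply: utilWc_geU0; case: (svalP i).
    - move=> F; apply: contrapT => noZ; apply: (noF F) => Q QQQ.
      apply: contrapT => noi; apply: noZ.
      have [Z dZ] := density_of_exists (QP _ QQQ); exists Z; first by exists Q.
      move=> i Fi; rewrite (bridge _ _ _ dZ) leNgt; apply/negP => bi.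
      by apply: noi; exists i.
    have [i bi] := Qb _ QQQ.
    by have := hZ i; rewrite (bridge _ _ _ dZ) leNgt bi.
  have [||||k _ hk] := @finite_minimax R _ I setT f F _ _ _ QQ a b ab _ FP.
  - move=> i j t _ _ t01; have [bi bj] := (svalP i, svalP j).
    exists (exist _ _ (bounded_claims_convex t01 bi bj)) => // Q.
    have [[_ XXi] [_ XXj]] := (bi, bj).
    have [iI iJ] := (utilWc_integrable Q bi, utilWc_integrable Q bj).
    have iZ (r : R) l : Xb l ->
        Q.-integrable setT (EFin \o (fun w => r * utilWc U W l w)).
      move=> bl; have := integrableZl measurableT r (utilWc_integrable Q bl).
      by apply: eq_integrable => // w _ /=; rewrite EFinM.
    rewrite /f /= -!RintegralZl // -RintegralD //; [|exact: iZ..].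
    apply: le_Rintegral => //; last by move=> w _; exact: utilWc_concave.
      have := integrableD measurableT (iZ t _ bi) (iZ (1 - t) _ bj).
      by apply: eq_integrable => // w _ /=; rewrite EFinD.
    exact/utilWc_integrable/bounded_claims_convex.
  - by have [i _] := Qb _ QQi; exists i.
  - by [].
  - move=> Q1 Q2 t Q1Q Q2Q t01; have [Q QQQ QE] := cQ _ _ _ Q1Q Q2Q t01.
    exists Q => // i _; have [_ XX] := svalP i.
    have mi := measurable_utilWc_claims XX.
    have gE Q' : (\int[Q']_w (utilWc U W (sval i) w - U 0)%:E = (f i Q' - U 0)%:E)%E.
      by rewrite EFinB -fE (expectation_shift _ mi (fun w => utilWc_geU0 w XX)) addeK.
    have mh : measurable_fun setT (fun w => (utilWc U W (sval i) w - U 0)%:E).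
      exact/measurable_EFinP/measurable_funB.
    have h0 w : (0 <= (utilWc U W (sval i) w - U 0)%:E)%E.
      by rewrite lee_fin subr_ge0; exact: utilWc_geU0.
    have := integral_mixture t01 QE mh h0.
    by rewrite !gE -!EFinM -EFinD => -[]; lra.
  apply: (@le_trans _ _ (ereal_inf [set 'E_Q[utilWc U W (sval k)] | Q in QQ])%E).
    by apply: le_ereal_inf_tmp => _ [Q QQQ <-]; rewrite fE lee_fin; exact: hk.
  by apply: ereal_sup_ubound; exists (sval k) => //; case: (svalP k).
have lo : ((U 0)%:E <= sup_inf XW QQ (utilWc U W))%E.
  apply: le_ereal_sup_tmp.
  exists (ereal_inf [set 'E_Q[utilWc U W (cst 0%R)] | Q in QQ])%E.
    by exists (cst 0) => //; exact: claims_below0.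
  apply: le_ereal_inf_tmp => _ [Q QQQ <-]; apply: expectation_ge => [|w].
    exact: measurable_utilWc_claims claims_below0.
  exact: utilWc_geU0 claims_below0.
rewrite leNgt; apply/negP => lt.
move: lo lt key; case: (sup_inf _ _ _) => [r| |]; last 2 first.
- by move=> _; rewrite ltNge leey.
- by move=> /(lt_le_trans (ltNyr _)); rewrite ltxx.
case: (inf_sup _ _ _) => [s| |] _; last by rewrite ltNge leNye.
  (* Two levels strictly inside the supposed gap between [r] and [s]. *)
  rewrite lte_fin => rs /(_ ((2 * r + s) / 3) ((r + 2 * s) / 3)).
  by rewrite lte_fin lee_fin => h; have := h _ _; lra.
by move=> _ /(_ (r + 1) (r + 2)); rewrite ltry lee_fin => h; have := h _ _; lra.
Qed.

End RobustMinimax.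

(** * Assembling the chain of values *)

Unset Implicit Arguments.

Local Open Scope ereal_scope.

Theorem theorem2 (R : realType) (d : measure_display) (Omega : measurableType d)
  (P Qe : probability Omega R) (QQ : set (probability Omega R))
  (U : R -> R) (W : {mfun Omega >-> R}) (x : R)
  (hQe : equivalent_probability P Qe)
  (hW : forall w, (0 < W w)%R)
  (U_nd : nondecreasing_on_nneg U)
  (U_usc : usc_on_nneg U)
  (U_sublinear : sublinear U)
  (x_gt0 : (0 < x)%R)
  (hx : x%:E < 'E_Qe[W])
  (QQ_convex : convex_probabilities QQ)
  (QQ_null : same_null_sets P QQ)
  (Z_closed : closed_in_L0 P (densities P QQ))
  (Ze_closed : closed_in_L0 P (densities P (equivalent_part P QQ)))
  (U_finite : forall y : R, (0 < y)%R ->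
     exists2 Q0, equivalent_part P QQ Q0 &
       ereal_sup [set 'E_Q0[U \o X] | X in claims Qe y] < +oo)
  (Uc_finite : exists2 Q0, equivalent_part P QQ Q0 &
     exists2 y : R, (0 < y)%R &
       ereal_sup [set 'E_Q0[concavification U \o X] | X in claims Qe y] < +oo)
  (Omega_borel : standard_borel R Omega)
  (W_atomless : atomless_cond_distribution P W) :
  let QQe := equivalent_part P QQ in
  let XW := claims_below Qe W x in
  [/\ sup_inf XW QQe (utilWc U W) = sup_inf XW QQ (utilWc U W),
      sup_inf XW QQ (utilWc U W) = inf_sup XW QQ (utilWc U W),
      inf_sup XW QQ (utilWc U W) = inf_sup XW QQe (utilWc U W)
    & inf_sup XW QQe (utilWc U W) = inf_sup XW QQe (utilW U W)] /\
  sup_inf XW QQe (utilW U W) <= sup_inf XW QQe (utilWc U W) /\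
  [/\ sup_inf XW QQe (utilW U W) = sup_inf XW QQ (utilW U W),
      sup_inf XW QQ (utilW U W) <= inf_sup XW QQ (utilW U W)
    & inf_sup XW QQ (utilW U W) <= inf_sup XW QQe (utilW U W)].
Proof.
move=> QQe XW.
have [C [mC sepC]] := standard_borel_separating Omega_borel.
have mW : measurable_fun setT W by [].
have QP Q : QQ Q -> Q `<< P.
  by move=> QQQ; apply/dominatesP => A mA PA; exact: ((QQ_null A mA).1 PA).
have P0 w : P [set w] = 0.
  by apply: (atomless_cond_set1 hW W_atomless); exact: separating_measurable1 mC sepC.
have dom0 (Q : probability Omega R) w : Q `<< P -> Q [set w] = 0.
  move=> /dominatesP; apply; last exact: P0.
  exact: separating_measurable1 mC sepC.
have XW0 : XW (cst 0%R) by exact: claims_below0.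
have mU X : XW X -> measurable_fun setT (utilW U W X) by exact: measurable_utilW_claims.
have mUc X : XW X -> measurable_fun setT (utilWc U W X) by exact: measurable_utilWc_claims.
have geU X w : XW X -> (U 0 <= utilW U W X w)%R by exact: utilW_geU0.
have geUc X w : XW X -> (U 0 <= utilWc U W X w)%R by exact: utilWc_geU0.
have U_le_Uc X w : XW X -> (utilW U W X w <= utilWc U W X w)%R.
  by move=> /claims_belowP[_ _ X0 _]; exact: concavification_ge.
have EU_le_Uc Q X : XW X -> 'E_Q[utilW U W X] <= 'E_Q[utilWc U W X].
  move=> XX; apply: (@expectation_le _ _ _ _ _ _ (U 0%R)) => [| |w|w].
  - exact: mU.
  - exact: mUc.
  - exact: geU.
  - exact: U_le_Uc.
(* Equivalence of [Q] with [P] gives [Qe] a density with respect to [Q], the price density in the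
   Lagrange bound. *)
have value_eq Q : QQe Q -> ereal_sup [set 'E_Q[utilWc U W X] | X in XW] =
    ereal_sup [set 'E_Q[utilW U W X] | X in XW].
  move=> [QQQ [Q_P P_Q]]; apply/eqP; rewrite eq_le; apply/andP; split; last first.
    apply: ge_ereal_sup => _ [X XX <-]; apply: le_trans (EU_le_Uc _ _ XX) _.
    by apply: ereal_sup_ubound; exists X.
  have [Y dY] := density_of_exists (null_dominates_trans hQe.1 P_Q).
  have lo : (U 0%R)%:E <= ereal_sup [set 'E_Q[utilW U W X] | X in XW].
    apply: le_ereal_sup_tmp; exists 'E_Q[utilW U W (cst 0%R)]; first by exists (cst 0%R).
    by apply: expectation_ge => [|w]; [exact: mU|exact: geU].
  move: lo; case sE : (ereal_sup [set 'E_Q[utilW U W X] | X in XW]) => [m| |]; last 2 first.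
  - by move=> _; rewrite leey.
  - by move=> /(lt_le_trans (ltNyr _)); rewrite ltxx.
  move=> _; apply: ge_ereal_sup => _ [X XX <-].
  apply: (concavified_value_le U_nd mW hW mC sepC _ _ x_gt0 dY) XX => [w|w|X' XX'].
  - exact: dom0.
  - exact: dom0 hQe.1.
  - by rewrite -sE; apply: ereal_sup_ubound; exists X'.
have [Q0 QQ0 Q0_fin] := U_finite _ x_gt0.
have [s0 s0P] : exists s0 : R, forall X, XW X -> 'E_Q0[utilW U W X] <= s0%:E.
  have [s0 hs0] : exists s0 : R, ereal_sup [set 'E_Q0[U \o X] | X in claims Qe x] <= s0%:E.
    move: Q0_fin; case: (ereal_sup _) => [r| |] //; first by exists r.
    by exists 0%R; rewrite leNye.
  exists s0 => X XX; apply: le_trans hs0.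
  have [mX _ X0 _] := claims_belowP XX.
  apply: le_ereal_sup_tmp; exists 'E_Q0[U \o X].
    by exists X => //; case: XX => LX bX EX; split.
  apply: (@expectation_le _ _ _ _ _ _ (U 0%R)) => [| |w|w].
  - exact: mU.
  - exact: measurable_nondecreasing_comp.
  - exact: geU.
  - exact: truncation_le_id.
(* Since [Q0] is equivalent to [P], [value_eq] carries the bound for [U^W] over to [U_c^W]. *)
have s0Pc X : XW X -> 'E_Q0[utilWc U W X] <= s0%:E.
  move=> XX; apply: (@le_trans _ _ (ereal_sup [set 'E_Q0[utilWc U W X] | X in XW])).
    by apply: ereal_sup_ubound; exists X.
  by rewrite value_eq //; apply: ge_ereal_sup => _ [X' XX' <-]; exact: s0P.
(* For a single claim, the mixing argument is applied to the one-element family of its payoff. *)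
have inf_eq u X : (forall X, XW X -> measurable_fun setT (u X)) ->
    (forall X w, XW X -> U 0 <= u X w)%R -> (forall X, XW X -> 'E_Q0[u X] <= s0%:E) ->
    XW X -> ereal_inf [set 'E_Q[u X] | Q in QQe] = ereal_inf [set 'E_Q[u X] | Q in QQ].
  move=> mu gu su XX.
  have := @inf_sup_equivalent_part _ _ _ P QQ Q0 [set u X] (U 0%R) s0 QQ_convex QP QQ0.
  have supE (S : set (probability Omega R)) :
      [set ereal_sup [set 'E_Q[f] | f in [set u X]] | Q in S] = [set 'E_Q[u X] | Q in S].
    by apply: eq_imagel => Q _; rewrite image_set1 ereal_sup1.
  rewrite !supE; apply.
  - by exists (u X).
  - by move=> _ ->; split => [|w]; [exact: mu|exact: gu].
  - by move=> _ ->; exact: su.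
have sup_inf_eq u : (forall X, XW X -> measurable_fun setT (u X)) ->
    (forall X w, XW X -> U 0 <= u X w)%R -> (forall X, XW X -> 'E_Q0[u X] <= s0%:E) ->
    sup_inf XW QQe u = sup_inf XW QQ u.
  move=> mu gu su; congr ereal_sup; apply: eq_imagel => X XX; exact: inf_eq.
have inf_sup_eq : inf_sup XW QQe (utilWc U W) = inf_sup XW QQ (utilWc U W).
  have := @inf_sup_equivalent_part _ _ _ P QQ Q0 [set utilWc U W X | X in XW] (U 0%R) s0
    QQ_convex QP QQ0.
  have supE (S : set (probability Omega R)) :
      [set ereal_sup [set 'E_Q[f] | f in [set utilWc U W X | X in XW]] | Q in S] =
      [set ereal_sup [set 'E_Q[utilWc U W X] | X in XW] | Q in S].
    by apply: eq_imagel => Q _; rewrite image_comp.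
  rewrite !supE; apply.
  - by exists (utilWc U W (cst 0%R)), (cst 0%R).
  - by move=> _ [X XX <-]; split => [|w]; [exact: mUc|exact: geUc].
  - by move=> _ [X XX <-]; exact: s0Pc.
split; [split|split; [|split]].
- exact: sup_inf_eq.
- apply: (robust_minimax U_nd U_sublinear mW hW Qe x_gt0 QQ_convex QP) => //.
  by exists Q0; case: QQ0.
- by [].
- by congr ereal_inf; apply: eq_imagel => Q; exact: value_eq.
- apply: ge_ereal_sup => _ [X XX <-]; apply: le_ereal_sup_tmp.
  exists (ereal_inf [set 'E_Q[utilWc U W X] | Q in QQe]); first by exists X.
  apply: le_ereal_inf_tmp => _ [Q QQeQ <-]; apply: le_trans (EU_le_Uc _ _ XX).
  by apply: ereal_inf_lbound; exists Q.
- exact: sup_inf_eq.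
- apply: ge_ereal_sup => _ [X XX <-]; apply: le_ereal_inf_tmp => _ [Q QQQ <-].
  apply: (@le_trans _ _ 'E_Q[utilW U W X]); first by apply: ereal_inf_lbound; exists Q.
  by apply: ereal_sup_ubound; exists X.
- by apply: ereal_inf_le_tmp => _ [Q [QQQ _] <-]; exists Q.
Qed.
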